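(* Let $n$ be a natural number. The quantum isometry group $\widetilde{\mathsf{QISO}}{}^+\bigl(\mathbb{C}[S_n],\ell^2(S_n),D\bigr)$ of the spectral triple on $S_n$, where $D$ is multiplication by the length function on $S_n$ associated with the generators $s_1,\dots,s_{n-1}$, $s_i=(i,i+1)$, is isomorphic to the finite quantum group obtained as the doubling of the group algebra $\mathbb{C}[S_n]$ with its standard cocommutative Hopf algebra structure (the doubling being taken with respect to the automorphism $\theta$ of $S_n$ given by $\theta(s_i)=s_{n-i}$). In particular, the C$^*$-algebra of continuous functions on the quantum isometry group $\widetilde{\mathsf{QISO}}{}^+\bigl(\mathbb{C}[S_n],\ell^2(S_n),D\bigr)$ is isomorphic to $\mathbb{C}[S_n]\oplus\mathbb{C}[S_n]$. If $\{\sigma_1,\dots,\sigma_{n-1}\}$ and $\{\tau_1,\dots,\tau_{n-1}\}$ denote the generators $s_1,\dots,s_{n-1}$ in the first and second copy of $\mathbb{C}[S_n]$ inside $\mathbb{C}[S_n]\oplus\mathbb{C}[S_n]$ respectively (i.e. $\sigma_i=(s_i,0)$ and $\tau_i=(0,s_i)$), then the comultiplication $\Delta$ of $\widetilde{\mathsf{QISO}}{}^+\bigl(\mathbb{C}[S_n],\ell^2(S_n),D\bigr)$ is given by $$\Delta(\sigma_i)=\sigma_i\otimes\sigma_i+\tau_i\otimes\tau_{n-i},\qquad \Delta(\tau_i)=\sigma_i\otimes\tau_i+\tau_i\otimes\sigma_{n-i}.$$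
   Context: All algebras are $*$-algebras over $\mathbb{C}$ and automorphisms are $*$-automorphisms; $\mathbb{C}[S_n]$ is the group $*$-algebra (with $g^*=g^{-1}$), which is a finite-dimensional C$^*$-algebra. Length and Dirac operator: the length $\ell(x)$ of $x\in S_n$ is the minimal number of factors needed to write $x$ as a product of elements of $\{s_1,\dots,s_{n-1}\}$. $D$ is the operator $\delta_x\mapsto \ell(x)\delta_x$ on $\ell^2(S_n)$, and $\widehat{D}\colon\mathbb{C}[S_n]\to\mathbb{C}[S_n]$ is the linear map $x\mapsto \ell(x)x$ for $x\in S_n$. The canonical trace $\boldsymbol{\tau}$ on $\mathbb{C}[S_n]$ is evaluation at the neutral element $e$ (the coefficient of $e$). Isometric coactions: let $\mathbb{G}=(A,\Delta_A)$ be a compact quantum group ($A$ a unital C$^*$-algebra). A coaction of $\mathbb{G}$ on $\mathbb{C}[S_n]$ satisfying the Podleś condition is a unital $*$-homomorphism $\alpha\colon\mathbb{C}[S_n]\to\mathbb{C}[S_n]\otimes A$ with $(\alpha\otimes\mathrm{id})\circ\alpha=(\mathrm{id}\otimes\Delta_A)\circ\alpha$ and with $\mathrm{span}\{\alpha(x)(\mathbb{1}\otimes a)\mid x\in\mathbb{C}[S_n],\,a\in A\}$ dense in $\mathbb{C}[S_n]\otimes A$. It is isometric if (1) $(\boldsymbol{\tau}\otimes\mathrm{id})\alpha(x)=\boldsymbol{\tau}(x)\mathbb{1}$ for all $x\in\mathbb{C}[S_n]$, and (2) $\alpha\circ\widehat{D}=(\widehat{D}\otimes\mathrm{id})\circ\alpha$.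 Quantum isometry group: $\widetilde{\mathsf{QISO}}{}^+\bigl(\mathbb{C}[S_n],\ell^2(S_n),D\bigr)$ is the universal object in the category of compact quantum groups coacting isometrically on $\mathbb{C}[S_n]$. That is, it is a compact quantum group $\mathbb{K}=(K,\Delta)$ with an isometric coaction $\boldsymbol{\alpha}$ on $\mathbb{C}[S_n]$ such that for every compact quantum group $\mathbb{G}=(A,\Delta_A)$ and every isometric coaction $\alpha$ of $\mathbb{G}$ on $\mathbb{C}[S_n]$ there is a unique unital $*$-homomorphism $\Phi\colon K\to A$ with $(\Phi\otimes\Phi)\circ\Delta=\Delta_A\circ\Phi$ and $\alpha=(\mathrm{id}\otimes\Phi)\circ\boldsymbol{\alpha}$. (It is known that such a universal object exists.) Doubling (for finite-dimensional Hopf algebras, the only case needed here): let $(\mathcal{A},\Delta_{\mathcal A})$ be a finite-dimensional Hopf $*$-algebra with an order-two Hopf $*$-algebra automorphism $\theta$. Let $(\widehat{\mathcal{A}},\widehat{\Delta})$ be the dual Hopf algebra, and let $\widehat{\theta}$ be the automorphism $f\mapsto f\circ\theta$ of it. Let $\mathcal{B}=\widehat{\mathcal{A}}\rtimes_{\widehat{\theta}}\mathbb{Z}_2$ be the crossed product: it is generated by $\widehat{\mathcal{A}}$ and an element $U$ with $U^2=\mathbb{1}$ and $UxU=\widehat{\theta}(x)$ for $x\in\widehat{\mathcal A}$, and each element is uniquely $x+yU$ with $x,y\in\widehat{\mathcal{A}}$. Equip $\mathcal{B}$ with the comultiplication $\Delta_{\mathcal{B}}$ which extends $\widehat{\Delta}$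 and satisfies $\Delta_{\mathcal{B}}(U)=U\otimes U$. The doubling of $(\mathcal{A},\Delta_{\mathcal A},\theta)$ is the Hopf algebra dual to $(\mathcal{B},\Delta_{\mathcal{B}})$: its product is dual to $\Delta_{\mathcal{B}}$ and its comultiplication $\widetilde{\Delta}$ is given by $\widetilde{\Delta}(\xi)(b\otimes b')=\xi(bb')$. For $\mathcal{A}=\mathbb{C}[S_n]$ the standard cocommutative structure is $\Delta_{\mathcal A}(g)=g\otimes g$ for $g\in S_n$. The automorphism $\theta$ is conjugation by the longest element of $S_n$ with respect to $s_1,\dots,s_{n-1}$, so that $\theta(s_i)=s_{n-i}$.
   Formalization: The theorem is stated for n at least 3: for n at most 2 the automorphism θ is trivial, not of order two, and the claim fails (for n = 2 the quantum isometry group has the 2-dimensional algebra C[S_2], not C[S_2]⊕C[S_2]). *)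

(* Defs.v *)
From HB Require Import structures.
From mathcomp Require Import all_boot all_order all_algebra all_fingroup.
From mathcomp Require Import complex reals.

Set Implicit Arguments.
Unset Strict Implicit.
Unset Printing Implicit Defensive.

Import Order.TTheory GRing.Theory Num.Theory.

Local Open Scope ring_scope.

HB.mixin Record isStarAlgebra (C : numClosedFieldType) A
    of GRing.Algebra C A := {
  star : A -> A;
  starK : involutive star;
  starD : {morph star : x y / x + y};
  starZ : forall (c : C) x, star (c *: x) = c^* *: star x;
  starM : forall x y, star (x * y) = star y * star x }.

#[short(type="starAlgType")]
HB.structure Definition StarAlgebra (C : numClosedFieldType) :=
  {A of isStarAlgebra C A & GRing.Algebra C A}.

Definition is_star_hom (C : numClosedFieldType) (A B : starAlgType C)
    (f : A -> B) : Prop :=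
  [/\ linear f, f 1 = 1, {morph f : x y / x * y} & {morph f : x / star x}].

(* The norm is not [Num.norm]: MathComp's hierarchy has no common structure
   for (non-integral) rings and normed modules. *)
HB.mixin Record isCStarAlgebra (R : realType) A of StarAlgebra R[i] A := {
  cnorm : A -> R;
  cnorm_eq0 : forall x, cnorm x = 0 -> x = 0;
  cnormD : forall x y, cnorm (x + y) <= cnorm x + cnorm y;
  cnormZ : forall (c : R[i]) x, (cnorm (c *: x))%:C%C = `|c| * (cnorm x)%:C%C;
  cnormM : forall x y, cnorm (x * y) <= cnorm x * cnorm y;
  cnorm_star : forall x, cnorm (star x * x) = cnorm x ^+ 2;
  cnorm_complete : forall u : nat -> A,
    (forall e : R, 0 < e -> exists N, forall p q, (N <= p)%N -> (N <= q)%N ->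
       cnorm (u p - u q) < e) ->
    exists l, forall e : R, 0 < e -> exists N, forall p, (N <= p)%N ->
       cnorm (u p - l) < e }.

#[short(type="cstarAlgType")]
HB.structure Definition CStarAlgebra (R : realType) :=
  {A of isCStarAlgebra R A & StarAlgebra R[i] A}.

Definition lin_span (C : numClosedFieldType) (V : lmodType C)
    (P : V -> Prop) (v : V) : Prop :=
  exists (k : nat) (c : 'I_k -> C) (u : 'I_k -> V),
    (forall i, P (u i)) /\ v = \sum_i c i *: u i.

Definition cstar_dense (R : realType) (A : cstarAlgType R)
    (P : A -> Prop) : Prop :=
  forall (x : A) (e : R), 0 < e -> exists2 y, P y & cnorm (x - y) < e.

(* [t] exhibits [T] as the completion of the algebraic tensor product of
   [A] and [B] for some C*-norm. *)
Definition is_cstar_tensor (R : realType) (A B T : cstarAlgType R)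
    (t : A -> B -> T) : Prop :=
  [/\ (forall b, linear (fun a => t a b)) /\ (forall a, linear (t a)),
      [/\ t 1 1 = 1,
          forall a a' b b', t (a * a') (b * b') = t a b * t a' b'
        & forall a b, t (star a) (star b) = star (t a b)],
      forall (k : nat) (a : 'I_k -> A) (b : 'I_k -> B),
        (forall c : 'I_k -> R[i],
           \sum_i c i *: a i = 0 -> forall i, c i = 0) ->
        \sum_i t (a i) (b i) = 0 -> forall i, b i = 0
    & cstar_dense (lin_span (fun z => exists a b, z = t a b))].

(* Minimal tensor product: the C*-norm on the algebraic tensor product is the
   least one (by Takesaki's theorem this is the spatial norm). *)
Definition is_min_tensor (R : realType) (A B T : cstarAlgType R)
    (t : A -> B -> T) : Prop :=
  is_cstar_tensor t /\
  forall (T' : cstarAlgType R) (t' : A -> B -> T'), is_cstar_tensor t' ->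
  forall (k : nat) (a : 'I_k -> A) (b : 'I_k -> B),
    cnorm (\sum_i t (a i) (b i)) <= cnorm (\sum_i t' (a i) (b i)).

(* [F] is the tensor product of the unital *-homomorphisms [f] and [g],
   relative to the models [t] and [t'] of the tensor products. *)
Definition is_tensor_hom (R : realType) (A B T A' B' T' : cstarAlgType R)
    (t : A -> B -> T) (t' : A' -> B' -> T') (f : A -> A') (g : B -> B')
    (F : T -> T') : Prop :=
  is_star_hom F /\ forall a b, F (t a b) = t' (f a) (g b).

(* The triple tensor product is one algebra [A3], exhibited both as
   (A (x) A) (x) A by [tl] and as A (x) (A (x) A) by [tr]. *)
Definition coassociative (R : realType) (A A2 : cstarAlgType R)
    (t : A -> A -> A2) (Delta : A -> A2) : Prop :=
  exists (A3 : cstarAlgType R) (tl : A2 -> A -> A3) (tr : A -> A2 -> A3),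
    [/\ is_min_tensor tl, is_min_tensor tr,
        forall a b c, tl (t a b) c = tr a (t b c)
      & exists Delta_id id_Delta : A2 -> A3,
          [/\ is_tensor_hom t tl Delta id Delta_id,
              is_tensor_hom t tr id Delta id_Delta
            & forall a, Delta_id (Delta a) = id_Delta (Delta a)]].

Record compact_quantum_group (R : realType) := CompactQuantumGroup {
  cqg_alg :> cstarAlgType R;
  cqg_alg2 : cstarAlgType R;
  cqg_tens : cqg_alg -> cqg_alg -> cqg_alg2;
  cqg_tensP : is_min_tensor cqg_tens;
  cqg_comul : cqg_alg -> cqg_alg2;
  cqg_comul_hom : is_star_hom cqg_comul;
  cqg_coassoc : coassociative cqg_tens cqg_comul;
  cqg_density_l : cstar_dense (lin_span
    (fun z => exists a b, z = cqg_comul a * cqg_tens b 1));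
  cqg_density_r : cstar_dense (lin_span
    (fun z => exists a b, z = cqg_comul a * cqg_tens 1 b)) }.

Arguments cqg_tens {R c}.
Arguments cqg_comul {R c}.

Definition cqg_compatible (R : realType) (K G : compact_quantum_group R)
    (Phi : K -> G) : Prop :=
  is_star_hom Phi /\
  exists Phi2 : cqg_alg2 K -> cqg_alg2 G,
    is_tensor_hom cqg_tens cqg_tens Phi Phi Phi2 /\
    forall a, Phi2 (cqg_comul a) = cqg_comul (Phi a).

Definition basis_vec (I : finType) (A : pzSemiRingType) (i : I) :
    {ffun I -> A} := [ffun j => (j == i)%:R].

(* The group algebra A[G]; it is also the algebraic tensor product C[G] (x) A,
   the element x (x) a being [g |-> x g *: a]. *)
Definition galg (G : finGroupType) (A : Type) : Type := {ffun G -> A}.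

Section GroupAlgebra.
Variables (C : numClosedFieldType) (G : finGroupType).

Section Alg.
Variable A : algType C.
Implicit Types f g h : galg G A.

HB.instance Definition _ := GRing.Lmodule.copy (galg G A) {ffun G -> A}.

Definition galg_one : galg G A := basis_vec A (1%g : G).
Definition galg_mul f g : galg G A :=
  [ffun z => \sum_(x : G) f x * g (x^-1 * z)%g].

Lemma galg_mulA : associative galg_mul.
Proof.
move=> f g h; apply/ffunP => z; rewrite !ffunE.
under eq_bigr => x _ do rewrite ffunE big_distrr /=.
under [RHS]eq_bigr => x _ do rewrite ffunE big_distrl /=.
rewrite [RHS]exchange_big /=; apply: eq_bigr => x _.
rewrite [RHS](reindex_inj (mulgI x)) /=; apply: eq_bigr => y _.
by rewrite mulKg mulrA invMg mulgA.
Qed.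

Lemma galg_mul1l : left_id galg_one galg_mul.
Proof.
move=> f; apply/ffunP => z; rewrite ffunE (bigD1 1%g) //= big1 => [|x xn1].
  by rewrite ffunE eqxx mul1r invg1 mul1g addr0.
by rewrite ffunE (negbTE xn1) mul0r.
Qed.

Lemma galg_mul1r : right_id galg_one galg_mul.
Proof.
move=> f; apply/ffunP => z; rewrite ffunE (bigD1 z) //= big1 => [|x xnz].
  by rewrite ffunE mulVg eqxx mulr1 addr0.
by rewrite ffunE -eq_mulVg1 (negbTE xnz) mulr0.
Qed.

Lemma galg_mulDl : left_distributive galg_mul +%R.
Proof.
move=> f g h; apply/ffunP => z; rewrite !ffunE -big_split /=.
by apply: eq_bigr => x _; rewrite ffunE mulrDl.
Qed.

Lemma galg_mulDr : right_distributive galg_mul +%R.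
Proof.
move=> f g h; apply/ffunP => z; rewrite !ffunE -big_split /=.
by apply: eq_bigr => x _; rewrite ffunE mulrDr.
Qed.

Lemma galg_one_neq0 : galg_one != 0.
Proof. by apply/eqP=> /ffunP/(_ 1%g)/eqP; rewrite !ffunE eqxx oner_eq0. Qed.

HB.instance Definition _ := GRing.Zmodule_isNzRing.Build (galg G A)
  galg_mulA galg_mul1l galg_mul1r galg_mulDl galg_mulDr galg_one_neq0.

Lemma galg_scaleAl (c : C) f g : c *: (f * g) = (c *: f) * g.
Proof.
apply/ffunP => z; rewrite !ffunE scaler_sumr.
by apply: eq_bigr => x _; rewrite ffunE scalerAl.
Qed.

HB.instance Definition _ :=
  GRing.Lmodule_isLalgebra.Build C (galg G A) galg_scaleAl.

Lemma galg_scaleAr (c : C) f g : c *: (f * g) = f * (c *: g).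
Proof.
apply/ffunP => z; rewrite !ffunE scaler_sumr.
by apply: eq_bigr => x _; rewrite ffunE scalerAr.
Qed.

HB.instance Definition _ :=
  GRing.Lalgebra_isAlgebra.Build C (galg G A) galg_scaleAr.

End Alg.

Section Star.
Variable A : starAlgType C.
Implicit Types f g : galg G A.

Definition galg_star f : galg G A := [ffun x => star (f (x^-1)%g)].

Lemma galg_starK : involutive galg_star.
Proof. by move=> f; apply/ffunP => x; rewrite !ffunE invgK starK. Qed.

Lemma galg_starD : {morph galg_star : f g / f + g}.
Proof. by move=> f g; apply/ffunP => x; rewrite !ffunE starD. Qed.

Lemma galg_starZ (c : C) f : galg_star (c *: f) = c^* *: galg_star f.
Proof. by apply/ffunP => x; rewrite !ffunE starZ. Qed.

Lemma galg_starM f g : galg_star (f * g) = galg_star g * galg_star f.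
Proof.
have star0 : star (0 : A) = 0.
  by apply: (addIr (star 0)); rewrite -starD !add0r.
apply/ffunP => z; rewrite !ffunE.
rewrite (big_morph _ (@starD _ A) star0).
rewrite (reindex_inj (mulgI z^-1)%g) /=; apply: eq_bigr => x _.
by rewrite starM !ffunE !invMg !invgK mulgK.
Qed.

HB.instance Definition _ := isStarAlgebra.Build C (galg G A)
  galg_starK galg_starD galg_starZ galg_starM.

End Star.
End GroupAlgebra.

Section StarInstances.
Variable C : numClosedFieldType.

Definition regular_star (x : C^o) : C^o := (x : C)^*.

Lemma regular_starK : involutive regular_star.
Proof. exact: conjCK. Qed.
Lemma regular_starD : {morph regular_star : x y / x + y}.
Proof. exact: rmorphD. Qed.
Lemma regular_starZ (c : C) x : regular_star (c *: x) = c^* *: regular_star x.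
Proof. exact: rmorphM. Qed.
Lemma regular_starM x y : regular_star (x * y) = regular_star y * regular_star x.
Proof. by rewrite mulrC; exact: rmorphM. Qed.

HB.instance Definition _ := isStarAlgebra.Build C C^o
  regular_starK regular_starD regular_starZ regular_starM.

Variables A B : starAlgType C.

Definition pair_star (x : A * B) : A * B := (star x.1, star x.2).

Lemma pair_starK : involutive pair_star.
Proof. by case=> a b; rewrite /pair_star /= !starK. Qed.
Lemma pair_starD : {morph pair_star : x y / x + y}.
Proof. by move=> x y; rewrite /pair_star /= !starD. Qed.
Lemma pair_starZ (c : C) x : pair_star (c *: x) = c^* *: pair_star x.
Proof. by rewrite /pair_star /= !starZ. Qed.
Lemma pair_starM x y : pair_star (x * y) = pair_star y * pair_star x.
Proof. by rewrite /pair_star /= !starM. Qed.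

HB.instance Definition _ := isStarAlgebra.Build C (A * B)%type
  pair_starK pair_starD pair_starZ pair_starM.

End StarInstances.

(* Structure maps of a Hopf *-algebra on the space with basis [I]; the tensor
   square is the space with basis [I * I].  Forming duals and crossed products
   uses only these maps, so the axioms are not part of the record. *)
Record hopf_maps (C : numClosedFieldType) (I : finType) := HopfMaps {
  hmul : {ffun I -> C^o} -> {ffun I -> C^o} -> {ffun I -> C^o};
  hone : {ffun I -> C^o};
  hcomul : {ffun I -> C^o} -> {ffun I * I -> C^o};
  hcounit : {ffun I -> C^o} -> C;
  hantipode : {ffun I -> C^o} -> {ffun I -> C^o};
  hstar : {ffun I -> C^o} -> {ffun I -> C^o} }.

Section Doubling.
Variables (C : numClosedFieldType) (I : finType).

Definition tensv (u v : {ffun I -> C^o}) : {ffun I * I -> C^o} :=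
  [ffun p => u p.1 * v p.2].

(* [f] is seen as the functional with value [f i] at the [i]-th basis vector *)
Definition pairing (J : finType) (f v : {ffun J -> C^o}) : C :=
  \sum_j f j * v j.

(* The dual Hopf *-algebra, written in the dual basis; the involution is the
   usual one, f^*(a) = conj (f (S(a)^* )). *)
Definition hopf_dual (H : hopf_maps C I) : hopf_maps C I :=
  let e (i : I) := basis_vec C^o i in
  {| hmul := fun f g => [ffun i => pairing (tensv f g) (hcomul H (e i))];
     hone := [ffun i => hcounit H (e i)];
     hcomul := fun f => [ffun p => pairing f (hmul H (e p.1) (e p.2))];
     hcounit := fun f => pairing f (hone H);
     hantipode := fun f => [ffun i => pairing f (hantipode H (e i))];
     hstar := fun f =>
       [ffun i => (pairing f (hstar H (hantipode H (e i))))^*] |}.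

(* The element x + y U of the crossed product by Z_2 has coordinates
   (i, false) |-> x i and (i, true) |-> y i. *)
Definition crossed_elt (x y : {ffun I -> C^o}) : {ffun I * bool -> C^o} :=
  [ffun p => if p.2 then y p.1 else x p.1].
Definition crossed_part (b : bool) (v : {ffun I * bool -> C^o}) :
    {ffun I -> C^o} := [ffun i => v (i, b)].

Definition crossed_product (H : hopf_maps C I)
    (theta : {ffun I -> C^o} -> {ffun I -> C^o}) : hopf_maps C (I * bool)%type :=
  let x := crossed_part false in
  let y := crossed_part true in
  {| (* U a = theta(a) U and U^2 = 1 *)
     hmul := fun u v => crossed_elt
       (hmul H (x u) (x v) + hmul H (y u) (theta (y v)))
       (hmul H (x u) (y v) + hmul H (y u) (theta (x v)));
     hone := crossed_elt (hone H) 0;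
     (* U is group-like *)
     hcomul := fun u => [ffun p =>
       if p.1.2 == p.2.2
       then hcomul H (crossed_part p.1.2 u) (p.1.1, p.2.1) else 0];
     hcounit := fun u => hcounit H (x u) + hcounit H (y u);
     (* S(a U) = U S(a) and (a U)^* = U a^* *)
     hantipode := fun u => crossed_elt
       (hantipode H (x u)) (theta (hantipode H (y u)));
     hstar := fun u => crossed_elt
       (hstar H (x u)) (theta (hstar H (y u))) |}.

Definition theta_dual (theta : {ffun I -> C^o} -> {ffun I -> C^o})
    (f : {ffun I -> C^o}) : {ffun I -> C^o} :=
  [ffun i => pairing f (theta (basis_vec C^o i))].

End Doubling.

Definition doubling (C : numClosedFieldType) (I : finType)
    (H : hopf_maps C I) (theta : {ffun I -> C^o} -> {ffun I -> C^o}) :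
    hopf_maps C (I * bool)%type :=
  hopf_dual (crossed_product (hopf_dual H) (theta_dual theta)).

Definition group_hopf (C : numClosedFieldType) (G : finGroupType) :
    hopf_maps C G :=
  {| hmul := fun u v => (u : galg G C^o) * (v : galg G C^o);
     hone := (1 : galg G C^o);
     hcomul := fun u => \sum_(g : G) u g *: basis_vec C^o (g, g);
     hcounit := fun u => \sum_(g : G) u g;
     hantipode := fun u => \sum_(g : G) u g *: basis_vec C^o (g^-1)%g;
     hstar := fun u => star (u : galg G C^o) |}.

(* Isomorphism of a compact quantum group with the finite quantum group given
   by Hopf *-algebra structure maps. *)
Definition cqg_iso_hopf (R : realType) (K : compact_quantum_group R)
    (I : finType) (H : hopf_maps R[i] I) : Prop :=
  exists F : {ffun I -> R[i]^o} -> K,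
    [/\ linear F /\ bijective F,
        F (hone H) = 1,
        forall u v, F (hmul H u v) = F u * F v,
        forall u, F (hstar H u) = star (F u)
      & forall u, cqg_comul (F u) =
          \sum_(p : I * I) hcomul H u p *:
            cqg_tens (F (basis_vec R[i]^o p.1)) (F (basis_vec R[i]^o p.2))].

Section SymmetricGroup.
Variable n : nat.

Lemma lower_proof (i : 'I_n.-1) : (i < n)%N.
Proof. by case: n i => [|m] [i hi] //=; exact: ltnW. Qed.
Lemma upper_proof (i : 'I_n.-1) : (i.+1 < n)%N.
Proof. by case: n i => [|m] [i hi]. Qed.

(* With [i] counted from 0, [sgen i] is the transposition s_(i+1); hence the
   index n - (i+1) becomes [rev_ord i]. *)
Definition sgen (i : 'I_n.-1) : 'S_n :=
  tperm (Ordinal (lower_proof i)) (Ordinal (upper_proof i)).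

Definition is_word (x : 'S_n) (k : nat) : bool :=
  [exists w : k.-tuple 'I_n.-1, (\prod_(i <- w) sgen i)%g == x].

Lemma is_wordP x k : reflect
  (exists2 w : seq 'I_n.-1, size w = k & (\prod_(i <- w) sgen i)%g = x)
  (is_word x k).
Proof.
apply: (iffP existsP) => [[w /eqP <-]|[w <- <-]].
  by exists w; rewrite ?size_tuple.
by exists (in_tuple w).
Qed.

Lemma is_word_mul x y : (exists k, is_word x k) -> (exists k, is_word y k) ->
  exists k, is_word (x * y)%g k.
Proof.
move=> [k /is_wordP[v _ <-]] [l /is_wordP[w _ <-]].
by exists (size (v ++ w)); apply/is_wordP; exists (v ++ w); rewrite ?big_cat.
Qed.

Lemma is_word_sgen i : exists k, is_word (sgen i) k.
Proof. by exists 1%N; apply/is_wordP; exists [:: i]; rewrite ?big_seq1. Qed.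

Lemma is_word_tperm (a b : 'I_n) : exists k, is_word (tperm a b) k.
Proof.
wlog lab : a b / (a < b)%N.
  move=> W; case: (ltngtP a b) => [|/W|/val_inj ->]; first exact: W.
    by rewrite tpermC.
  by rewrite tperm1; exists 0; apply/is_wordP; exists [::]; rewrite ?big_nil.
have [d hd] : exists d, (b - a)%N = d.+1.
  by exists (b - a).-1; rewrite prednK // subn_gt0.
elim: d a b lab hd => [|d IH] a b lab hd.
  have hb : (b : nat) = a.+1 by rewrite -(subnK (ltnW lab)) hd add1n.
  have ha : (a < n.-1)%N by rewrite -ltnS (ltn_predK (ltn_ord b)) -hb.
  suff -> : tperm a b = sgen (Ordinal ha) by exact: is_word_sgen.
  by congr tperm; apply: val_inj; rewrite /= ?hb.
have hb : (b : nat) = (a + d.+2)%N by rewrite -(subnK (ltnW lab)) hd addnC.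
have hc : (a + d.+1 < n.-1)%N.
  by rewrite -ltnS (ltn_predK (ltn_ord b)) -addnS -hb.
pose s := sgen (Ordinal hc).
pose c : 'I_n := Ordinal (lower_proof (Ordinal hc)).
have sc : s c = b.
  by rewrite /s /sgen tpermL; apply: val_inj; rewrite /= hb -addnS.
have sa : s a = a.
  rewrite /s /sgen tpermD // -val_eqE /= gtn_eqF ?ltnS ?leq_addr //.
  by rewrite addnS ltnS leq_addr.
rewrite -sc -{1}sa -tpermJ conjgE tpermV.
have hw : exists k, is_word (tperm a c) k.
  by apply: IH; rewrite /= ?addnS ?ltnS ?leq_addr // -addnS addKn.
apply: is_word_mul; first exact: is_word_sgen.
by apply: is_word_mul => //; exact: is_word_sgen.
Qed.

Lemma is_word_ex x : exists k, is_word x k.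
Proof.
have [ts -> _] := prod_tpermP x; elim: ts => [|t ts IH].
  by rewrite big_nil; exists 0%N; apply/is_wordP; exists [::]; rewrite ?big_nil.
by rewrite big_cons; apply: is_word_mul IH; exact: is_word_tperm.
Qed.

Definition ell (x : 'S_n) : nat := ex_minn (is_word_ex x).

(* conjugation by the longest element, which is i |-> n - 1 - i *)
Definition reversal : 'S_n := perm (@rev_ord_inj n).
Definition theta (x : 'S_n) : 'S_n := (x ^ reversal)%g.

Lemma theta_sgen i : theta (sgen i) = sgen (rev_ord i).
Proof.
rewrite /theta /sgen tpermJ !permE tpermC.
have hi := upper_proof i.
by congr tperm; apply: val_inj => /=; move: hi; case: (n) i => [|m] i //= hi;
  rewrite !subSS ?subnSK.
Qed.

End SymmetricGroup.

Section QuantumIsometry.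
Variables (R : realType) (n : nat).

Local Notation CSn := (galg 'S_n R[i]^o).

(* x (x) a *)
Definition elem_tens (A : algType R[i]) (x : CSn) (a : A) : galg 'S_n A :=
  [ffun g => x g *: a].

(* id (x) f *)
Definition id_tens (A B : Type) (f : A -> B) (z : galg 'S_n A) :
    galg 'S_n B := [ffun g => f (z g)].

(* alpha (x) id, with values in C[S_n] (x) A2 where A2 is the tensor product
   of A and A' via [t] *)
Definition tens_id (A A2 : lmodType R[i]) (A' : Type) (t : A -> A' -> A2)
    (alpha : CSn -> galg 'S_n A) (z : galg 'S_n A') : galg 'S_n A2 :=
  [ffun h => \sum_(g : 'S_n) t (alpha (basis_vec R[i]^o g) h) (z g)].

(* For A = C this is the map denoted D^; in general it is D^ (x) id. *)
Definition Dhat (A : nmodType) (z : galg 'S_n A) : galg 'S_n A :=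
  [ffun g => z g *+ ell g].

Definition theta_lin (x : {ffun 'S_n -> R[i]^o}) : {ffun 'S_n -> R[i]^o} :=
  \sum_(g : 'S_n) x g *: basis_vec R[i]^o (theta g).

(* As C[S_n] is finite-dimensional, the C*-norm of C[S_n] (x) A = A[S_n] is
   equivalent to the maximum of the norms of the coefficients; density is
   expressed with the latter. *)
Definition podles (G : compact_quantum_group R)
    (alpha : CSn -> galg 'S_n G) : Prop :=
  forall (z : galg 'S_n G) (e : R), 0 < e ->
  exists2 y : galg 'S_n G,
    lin_span (fun w => exists x a, w = alpha x * elem_tens 1 a) y
    & forall g, cnorm (z g - y g) < e.

Definition is_coaction (G : compact_quantum_group R)
    (alpha : CSn -> galg 'S_n G) : Prop :=
  [/\ is_star_hom alpha,
      forall x, tens_id cqg_tens alpha (alpha x) = id_tens cqg_comul (alpha x)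
    & podles alpha].

Definition is_isometric (G : compact_quantum_group R)
    (alpha : CSn -> galg 'S_n G) : Prop :=
  (forall x, alpha x 1%g = x 1%g *: 1) /\
  (forall x, alpha (Dhat x) = Dhat (alpha x)).

Definition is_isometric_coaction (G : compact_quantum_group R)
    (alpha : CSn -> galg 'S_n G) : Prop :=
  is_coaction alpha /\ is_isometric alpha.

Definition is_quantum_isometry_group (K : compact_quantum_group R)
    (alpha : CSn -> galg 'S_n K) : Prop :=
  is_isometric_coaction alpha /\
  forall (G : compact_quantum_group R) (beta : CSn -> galg 'S_n G),
    is_isometric_coaction beta ->
    exists! Phi : K -> G,
      cqg_compatible Phi /\ forall x, beta x = id_tens Phi (alpha x).

Definition sigma (i : 'I_n.-1) : CSn * CSn := (basis_vec R[i]^o (sgen i), 0).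
Definition tau (i : 'I_n.-1) : CSn * CSn := (0, basis_vec R[i]^o (sgen i)).

End QuantumIsometry.

Arguments sigma R {n}.
Arguments tau R {n}.

(* Main.v *)
(** [C[S_n] (+) C[S_n]] is realised as the group algebra of [S_n x Z_2],
    with the operator norm of its left regular representation. The tensor
    powers are then group algebras of product groups, and they are minimal
    tensor products because any C*-norm [N] on [C[G]] satisfies [|x g| <= N
    (g^-1) N x] (the trace of left multiplication by [x] is the sum of
    eigenvalues, each at most [N x]); together with [N (x^* x) = N x ^ 2]
    this determines [N].

    For an isometric coaction [beta], let [beta s_i = sum_j s_j (x) q_ji].
    The matrix [u] of [beta] is unitary and multiplicative, and by unitarity
    also comultiplicative. Comparing the two expansions of [u (s_j s_l) (s_i
    s_k)] gives [q_ji q_lk = 0] whenever exactly one of the pairs [(j, l)],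
    [(i, k)] is adjacent. As the rows and columns of squares of [q] sum to
    [1], this leaves only the entries with [j = i] or [j = n - i], and the
    [q_ii ^ 2] with [i <> n - i] are one projection [p]. For the middle
    index [c], if any, the coefficient of [s_(c-1) s_c s_(c+1)] in the braid
    relation shows that [p] commutes with [q_cc]. So [p] is central, [p beta
    g = g (x) p u_gg] and [(1 - p) beta g = theta g (x) (1 - p) u_(theta g,
    g)]: this is a pair of orthogonal representations of [S_n], that is, a
    homomorphism from [C[S_n] (+) C[S_n]]. *)

From HB Require Import structures.
From mathcomp Require Import all_boot all_order all_algebra all_fingroup.
From mathcomp Require Import complex reals boolp classical_sets.
From mathcomp Require Import zify ring lra.
Require Import Defs.

Set Implicit Arguments.
Unset Strict Implicit.
Unset Printing Implicit Defensive.

Import Order.TTheory GRing.Theory Num.Theory.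
Import ComplexField.Normc.

Local Open Scope ring_scope.

(** * The C*-norm of a finite group algebra *)

(** Universality is tested against every compact quantum group, whose algebra and tensor square are
    arbitrary models, and the tensor square of the candidate must be minimal among all
    C*-completions. Hence the norm comparison is made for arbitrary *-homomorphisms out of a finite
    group algebra.

    The rigidity of [q] starts at the ends of the Dynkin diagram: an end has one neighbour and an
    interior vertex has two, so an entry joining them would equal twice itself. Moving inwards from
    the ends, only the identity and the reflection of the path survive.

    The condition [2 < n] makes [theta] move some generator. For smaller [n] it is the identity, the
    coefficients of the universal coaction all lie in the diagonal of C[S_n] (+) C[S_n], and they no
    longer determine [Phi]. *)

Lemma complex_normE (R : rcfType) (c : R[i]) : `|c| = (normc c)%:C%C.
Proof. by []. Qed.

Lemma normc_ge0 (R : rcfType) (c : R[i]) : 0 <= normc c.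
Proof. by rewrite -lecR -complex_normE normr_ge0. Qed.

Lemma normc_sum (R : rcfType) (I : finType) (F : I -> R[i]) :
  normc (\sum_i F i) <= \sum_i normc (F i).
Proof.
apply: (big_ind2 (fun a b => normc a <= b)) => //; first by rewrite normc0.
by move=> a b c d ab cd; apply: le_trans (le_normcD _ _) (lerD ab cd).
Qed.

Section HilbertNorm.
Variables (R : rcfType) (I : finType).
Implicit Types x y : {ffun I -> R[i]^o}.

Definition l2norm x : R := Num.sqrt (\sum_i normc (x i) ^+ 2).

Lemma l2norm_ge0 x : 0 <= l2norm x. Proof. exact: sqrtr_ge0. Qed.

Lemma sqr_l2norm x : l2norm x ^+ 2 = \sum_i normc (x i) ^+ 2.
Proof. by rewrite sqr_sqrtr // sumr_ge0 // => i _; rewrite sqr_ge0. Qed.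

Lemma normc_le_l2norm x i : normc (x i) <= l2norm x.
Proof.
rewrite -(ler_pXn2r (n := 2)) ?nnegrE ?normc_ge0 ?l2norm_ge0 //.
rewrite sqr_l2norm (bigD1 i) //= lerDl sumr_ge0 // => j _; exact: sqr_ge0.
Qed.

(** Lagrange's identity: twice the difference of the two sides is the sum of the squares of the
    minors [a i * b j - a j * b i]. *)
Lemma sum_sqr_CauchySchwarz (a b : I -> R) :
  (\sum_i a i * b i) ^+ 2 <= (\sum_i a i ^+ 2) * (\sum_i b i ^+ 2).
Proof.
have: 0 <= \sum_i \sum_j (a i * b j - a j * b i) ^+ 2.
  by do 2 apply: sumr_ge0 => ? _; rewrite sqr_ge0.
have -> : \sum_i \sum_j (a i * b j - a j * b i) ^+ 2 =
   2 * ((\sum_i a i ^+ 2) * (\sum_i b i ^+ 2) - (\sum_i a i * b i) ^+ 2).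
  have E (f g : I -> R) : (\sum_i f i) * (\sum_j g j) = \sum_i \sum_j f i * g j.
    by rewrite big_distrl; apply: eq_bigr => i _; rewrite big_distrr.
  set A := \sum_i a i ^+ 2; set B := \sum_i b i ^+ 2; set P := \sum_i a i * b i.
  have -> : 2 * (A * B - P ^+ 2) = A * B + B * A - 2 * (P * P) by ring.
  rewrite !E -big_split mulr_sumr -sumrB; apply: eq_bigr => i _ /=.
  rewrite -big_split mulr_sumr -sumrB; apply: eq_bigr => j _ /=; ring.
by rewrite pmulr_rge0 ?ltr0n // subr_ge0.
Qed.

Lemma l2_CauchySchwarz (a b : {ffun I -> R[i]^o}) :
  \sum_i normc (a i) * normc (b i) <= l2norm a * l2norm b.
Proof.
rewrite -(ler_pXn2r (n := 2)) ?nnegrE ?mulr_ge0 ?l2norm_ge0 //; last first.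
  by apply: sumr_ge0 => i _; rewrite mulr_ge0 ?normc_ge0.
by rewrite exprMn !sqr_l2norm sum_sqr_CauchySchwarz.
Qed.

Lemma l2normD x y : l2norm (x + y) <= l2norm x + l2norm y.
Proof.
rewrite -(ler_pXn2r (n := 2)) ?nnegrE ?addr_ge0 ?l2norm_ge0 //.
rewrite sqrrD !sqr_l2norm.
apply: (@le_trans _ _ (\sum_i (normc (x i) + normc (y i)) ^+ 2)).
  apply: ler_sum => i _; rewrite ffunE.
  by rewrite ler_pXn2r ?nnegrE ?addr_ge0 ?normc_ge0 ?le_normcD.
under eq_bigr => i _ do rewrite sqrrD.
by rewrite !big_split /= lerD2r lerD2l -mulr2n lerMn2r l2_CauchySchwarz orbT.
Qed.

Lemma l2normZ (c : R[i]) x : l2norm (c *: x) = normc c * l2norm x.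
Proof.
rewrite /l2norm; under eq_bigr => i _ do rewrite ffunE normcM exprMn.
by rewrite -mulr_sumr sqrtrM ?sqr_ge0 // sqrtr_sqr ger0_norm ?normc_ge0.
Qed.

Lemma l2norm0_eq0 x : l2norm x = 0 -> x = 0.
Proof.
move=> x0; apply/ffunP => i; rewrite ffunE; apply: eq0_normc.
by apply/le_anti; rewrite normc_ge0 -x0 normc_le_l2norm.
Qed.

Lemma l2norm_sum (J : finType) (F : J -> {ffun I -> R[i]^o}) :
  l2norm (\sum_j F j) <= \sum_j l2norm (F j).
Proof.
apply: (big_ind2 (fun a b => l2norm a <= b)) => //.
  by rewrite -[0](scale0r 0) l2normZ normc0 mul0r.
by move=> a b c d ab cd; apply: le_trans (l2normD _ _) (lerD ab cd).
Qed.

End HilbertNorm.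

(** * Completeness of the real and complex numbers *)

Section RealCompleteness.
Variable R : realType.

Lemma real_cauchy_cvg (u : nat -> R) :
  (forall e, 0 < e -> exists N, forall p q, (N <= p)%N -> (N <= q)%N ->
     `|u p - u q| < e) ->
  exists l, forall e, 0 < e -> exists N, forall p, (N <= p)%N -> `|u p - l| < e.
Proof.
(* [S] is the set of eventual lower bounds of [u], so [sup S] is its lower limit. *)
move=> cu; pose S := [set x | exists N, forall p, (N <= p)%N -> x <= u
  p]%classic.
have near e : 0 < e -> exists N, forall p, (N <= p)%N ->
    S (u p - e) /\ (forall x, S x -> x <= u p + e).
  move=> /cu [N hN]; exists N => p Np; split.
    exists N => q Nq; move: (hN p q Np Nq); rewrite ltr_norml => /andP[_]; lra.
  move=> x [M hM]; have := hM (maxn N M) (leq_maxr _ _).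
  move: (hN p (maxn N M) Np (leq_maxl _ _)).
  rewrite ltr_norml => /andP[+ _]; lra.
exists (sup S) => e e0; have [|N hN] := near (e / 2); first by rewrite divr_gt0.
exists N => p /hN[Sp ubp].
have : u p - e / 2 <= sup S by apply: ub_le_sup => //;
  exists (u p + e / 2) => x /ubp.
have : sup S <= u p + e / 2 by apply: ge_sup;
  [exists (u p - e / 2)|move=> x /ubp].
move=> h1 h2; rewrite ltr_norml; apply/andP; split; lra.
Qed.

Lemma normc_ge_absRe (z : R[i]) : `|complex.Re z| <= normc z.
Proof. by rewrite -lecR; exact: normc_ge_Re. Qed.

Lemma normc_ge_absIm (z : R[i]) : `|complex.Im z| <= normc z.
Proof. by case: z => a b /=; rewrite -sqrtr_sqr ler_wsqrtr // lerDr sqr_ge0.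
  Qed.

Lemma normc_le_ReIm (z : R[i]) :
  normc z <= `|complex.Re z| + `|complex.Im z|.
Proof.
case: z => a b /=; rewrite -[leRHS]ger0_norm ?addr_ge0 // -sqrtr_sqr.
rewrite ler_wsqrtr // sqrrD !real_normK ?num_real //.
by rewrite lerD2r lerDl mulrn_wge0 // mulr_ge0.
Qed.

Lemma complex_cauchy_cvg (u : nat -> R[i]) :
  (forall e, 0 < e -> exists N, forall p q, (N <= p)%N -> (N <= q)%N ->
     normc (u p - u q) < e) ->
  exists l, forall e, 0 < e -> exists N, forall p, (N <= p)%N -> normc (u p -
    l) < e.
Proof.
move=> cu.
have [a ha] : exists l, forall e, 0 < e -> exists N, forall p, (N <= p)%N ->
    `|complex.Re (u p) - l| < e.
  apply: real_cauchy_cvg => e /cu[N hN]; exists N => p q Np Nq.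
  by rewrite -raddfB; apply: le_lt_trans (hN p q Np Nq); exact: normc_ge_absRe.
have [b hb] : exists l, forall e, 0 < e -> exists N, forall p, (N <= p)%N ->
    `|complex.Im (u p) - l| < e.
  apply: real_cauchy_cvg => e /cu[N hN]; exists N => p q Np Nq.
  by rewrite -raddfB; apply: le_lt_trans (hN p q Np Nq); exact: normc_ge_absIm.
exists (a +i* b)%C => e e0.
have e20 : 0 < e / 2 by rewrite divr_gt0.
have [N1 h1] := ha _ e20; have [N2 h2] := hb _ e20.
exists (maxn N1 N2) => p; rewrite geq_max => /andP[/h1 r /h2 i].
apply: le_lt_trans (normc_le_ReIm _) _; rewrite !raddfB /=; lra.
Qed.

End RealCompleteness.

Section GroupAlgebraEntries.
Variables (C : numClosedFieldType) (G : finGroupType).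

Lemma galg_mulE (A : algType C) (x y : galg G A) z :
  (x * y) z = \sum_g x g * y (g^-1 * z)%g.
Proof. by rewrite ffunE. Qed.

Lemma galg_starE (A : starAlgType C) (x : galg G A) g :
  star x g = star (x g^-1%g).
Proof. by rewrite ffunE. Qed.

Lemma galg_conjE (x : galg G C^o) g : star x g = (x g^-1%g)^*.
Proof. by rewrite ffunE. Qed.

End GroupAlgebraEntries.

(** * The operator norm of the left regular representation *)

Section OperatorNorm.
Variables (R : realType) (G : finGroupType).
Local Notation CG := (galg G R[i]^o).
Implicit Types x y : CG.

(** The inner product of l^2(G), written through the trace, so that moving a left factor [x] to the
    other side as [star x] is associativity. *)
Definition gdot x y : R[i] := (star x * y) 1%g.

Lemma gdotE x y : gdot x y = \sum_g (x g)^* * y g.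
Proof.
rewrite /gdot galg_mulE (reindex_inj invg_inj) /=; apply: eq_bigr => g _.
by rewrite galg_conjE invgK mulg1.
Qed.

Lemma gdotxx x : gdot x x = (l2norm x ^+ 2)%:C%C.
Proof.
rewrite gdotE sqr_l2norm rmorph_sum /=; apply: eq_bigr => g _.
by rewrite rmorphXn /= -complex_normE normCKC.
Qed.

Lemma normc_gdot x y : normc (gdot x y) <= l2norm x * l2norm y.
Proof.
apply: le_trans (l2_CauchySchwarz x y); rewrite gdotE.
apply: le_trans (normc_sum _) _; apply: ler_sum => g _.
by rewrite normcM -lecR rmorphM /= -!complex_normE norm_conjC -rmorphM.
Qed.

Lemma l2norm1 : l2norm (1 : CG) = 1.
Proof.
apply/eqP; rewrite -(eqrXn2 (n := 2)) ?l2norm_ge0 // expr1n.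
have := gdotxx 1; rewrite /gdot mulr1 galg_conjE invg1 ffunE eqxx rmorph1.
by move=> /complexI <-.
Qed.

Definition opnorm_bounds x : set R :=
  [set M | 0 <= M /\ forall y, l2norm (x * y) <= M * l2norm y]%classic.

Definition opnorm x : R := inf (opnorm_bounds x).

(** Left translations are isometries of l^2(G). The existence of some bound is what gives [inf] its
    meaning in [opnorm]. *)
Lemma opnorm_bound_sum x : opnorm_bounds x (\sum_g normc (x g)).
Proof.
split=> [|y]; first by apply: sumr_ge0 => g _; exact: normc_ge0.
have -> : x * y = \sum_g x g *: ([ffun z => y (g^-1 * z)%g] : CG).
  apply/ffunP => z; rewrite galg_mulE sum_ffunE; apply: eq_bigr => g _.
  by rewrite !ffunE.
apply: le_trans (l2norm_sum _) _; rewrite mulr_suml; apply: ler_sum => g _.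
rewrite l2normZ ler_wpM2l ?normc_ge0 // ler_wsqrtr //.
rewrite (reindex_inj (mulgI g)) /=; apply: ler_sum => h _.
by rewrite ffunE mulKg.
Qed.

Lemma opnorm_has_lbound x : has_lbound (opnorm_bounds x).
Proof. by exists 0 => M []. Qed.

Lemma opnorm_le x M : opnorm_bounds x M -> opnorm x <= M.
Proof. exact/ge_inf/opnorm_has_lbound. Qed.

Lemma opnorm_ge0 x : 0 <= opnorm x.
Proof.
by apply: lb_le_inf => [|M []//]; exists (\sum_g normc (x g));
  exact: opnorm_bound_sum.
Qed.

Lemma opnorm_le_sum x : opnorm x <= \sum_g normc (x g).
Proof. exact/opnorm_le/opnorm_bound_sum. Qed.

Lemma le_opnorm x y : l2norm (x * y) <= opnorm x * l2norm y.
Proof.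
have [y0|y0] := eqVneq (l2norm y) 0.
  by rewrite y0 (l2norm0_eq0 y0) !mulr0 -[0](scale0r 0) l2normZ normc0 mul0r.
have yp : 0 < l2norm y by rewrite lt_neqAle eq_sym y0 l2norm_ge0.
rewrite -ler_pdivrMr //; apply: lb_le_inf => [|M [_ hM]].
  by exists (\sum_g normc (x g)); exact: opnorm_bound_sum.
by rewrite ler_pdivrMr.
Qed.

(** Test [x] on the unit vector [1]. Together with [opnorm_le_sum], convergence in [opnorm] becomes
    convergence of all coefficients, whence completeness. *)
Lemma normc_le_opnorm x g : normc (x g) <= opnorm x.
Proof.
apply: le_trans (normc_le_l2norm _ _) _; rewrite -[in leLHS](mulr1 x).
by apply: le_trans (le_opnorm _ _) _; rewrite l2norm1 mulr1.
Qed.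

Lemma opnorm_eq0 x : opnorm x = 0 -> x = 0.
Proof.
move=> x0; apply/ffunP => g; rewrite ffunE; apply: eq0_normc.
by apply/le_anti; rewrite normc_ge0 -x0 normc_le_opnorm.
Qed.

Lemma opnormD x y : opnorm (x + y) <= opnorm x + opnorm y.
Proof.
apply: opnorm_le; split=> [|z]; first by rewrite addr_ge0 ?opnorm_ge0.
rewrite mulrDl [leRHS]mulrDl; apply: le_trans (l2normD _ _) _.
by rewrite lerD ?le_opnorm.
Qed.

Lemma opnormZ_le (c : R[i]) x : opnorm (c *: x) <= normc c * opnorm x.
Proof.
apply: opnorm_le; split=> [|z]; first by rewrite mulr_ge0 ?opnorm_ge0
  ?normc_ge0.
by rewrite -scalerAl l2normZ -mulrA ler_wpM2l ?normc_ge0 ?le_opnorm.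
Qed.

Lemma opnormZ (c : R[i]) x : (opnorm (c *: x))%:C%C = `|c| * (opnorm x)%:C%C.
Proof.
rewrite complex_normE -rmorphM /=; congr (_%:C)%C; apply/le_anti.
rewrite opnormZ_le /=; have [->|c0] := eqVneq c 0.
  by rewrite normc0 mul0r opnorm_ge0.
rewrite -[in leLHS](scale1r x) -(mulVf c0) -scalerA.
apply: le_trans (ler_wpM2l (normc_ge0 _) (opnormZ_le _ _)) _.
rewrite mulrA normcV divff ?mul1r //.
by apply: contra_neq c0 => /eq0_normc.
Qed.

Lemma opnormM x y : opnorm (x * y) <= opnorm x * opnorm y.
Proof.
apply: opnorm_le; split=> [|z]; first by rewrite mulr_ge0 ?opnorm_ge0.
rewrite -mulrA; apply: le_trans (le_opnorm _ _) _.
by rewrite -mulrA ler_wpM2l ?opnorm_ge0 ?le_opnorm.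
Qed.

(** Cauchy-Schwarz applied to |x y|^2 = <y, x^* x y>. *)
Lemma sqr_opnorm_le x : opnorm x ^+ 2 <= opnorm (star x * x).
Proof.
have s0 : 0 <= opnorm (star x * x) by exact: opnorm_ge0.
rewrite -[leRHS]sqr_sqrtr // ler_pXn2r ?nnegrE ?opnorm_ge0 ?sqrtr_ge0 //.
apply: opnorm_le; split=> [|y]; first exact: sqrtr_ge0.
rewrite -(ler_pXn2r (n := 2)) ?nnegrE ?mulr_ge0 ?sqrtr_ge0 ?l2norm_ge0 //.
rewrite exprMn [Num.sqrt (opnorm _) ^+ 2]sqr_sqrtr //.
have -> : l2norm (x * y) ^+ 2 = normc (gdot y (star x * x * y)).
  apply: complexI; rewrite -gdotxx -[RHS]complex_normE.
  have E : star (x * y) * (x * y) = star y * (star x * x * y).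
    by rewrite (starM x y) -(mulrA (star y)) (mulrA (star x)).
  have <- : gdot (x * y) (x * y) = gdot y (star x * x * y).
    exact: (congr1 (fun v : CG => v 1%g) E).
  by rewrite ger0_norm // gdotxx lecR sqr_ge0.
apply: le_trans (normc_gdot _ _) _; rewrite expr2 mulrCA ler_wpM2l ?l2norm_ge0
  //.
exact: le_opnorm.
Qed.

Lemma opnorm_star_le x : opnorm x <= opnorm (star x).
Proof.
have [->|x0] := eqVneq (opnorm x) 0; first exact: opnorm_ge0.
have xp : 0 < opnorm x by rewrite lt_neqAle eq_sym x0 opnorm_ge0.
rewrite -(ler_pM2r xp) -[leLHS]expr2; apply: le_trans (sqr_opnorm_le x) _.
exact: opnormM.
Qed.

Lemma opnorm_star x : opnorm (star x * x) = opnorm x ^+ 2.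
Proof.
apply/le_anti; rewrite sqr_opnorm_le andbT.
have le_x : opnorm (star x) <= opnorm x.
  by have := opnorm_star_le (star x); rewrite (starK x).
by rewrite [leRHS]expr2 (le_trans (opnormM _ _) (ler_wpM2r (opnorm_ge0 x)
  le_x)).
Qed.

Lemma opnorm_complete (u : nat -> CG) :
    (forall e : R, 0 < e -> exists N, forall p q, (N <= p)%N -> (N <= q)%N ->
       opnorm (u p - u q) < e) ->
    exists l, forall e : R, 0 < e -> exists N, forall p, (N <= p)%N ->
       opnorm (u p - l) < e.
Proof.
move=> cu.
have /choice[l hl] g : exists l, forall e : R, 0 < e ->
    exists N, forall p, (N <= p)%N -> normc (u p g - l) < e.
  apply: complex_cauchy_cvg => e /cu[N hN]; exists N => p q Np Nq.
  apply: le_lt_trans (hN p q Np Nq).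
  by have := normc_le_opnorm (u p - u q) g; rewrite !ffunE.
exists [ffun g => l g] => e e0.
(* With the successor of [#|G|] as denominator, the [#|G|] coefficient errors add up to strictly
   less than [e]. *)
have e'0 : 0 < e / #|G|.+1%:R by rewrite divr_gt0 ?ltr0n.
have /choice[N hN] g := hl g _ e'0.
exists (\max_g N g)%N => p /bigmax_leqP hp.
apply: le_lt_trans (opnorm_le_sum _) _.
apply: (@le_lt_trans _ _ (\sum_(g : G) e / #|G|.+1%:R)).
  by apply: ler_sum => g _; rewrite !ffunE; apply/ltW/hN/hp.
rewrite sumr_const -[_ *+ _]mulr_natr mulrAC ltr_pdivrMr ?ltr0n //.
by rewrite ltr_pM2l // ltr_nat.
Qed.

HB.instance Definition _ := isCStarAlgebra.Build R (galg G R[i]^o)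
  opnorm_eq0 opnormD opnormZ opnormM opnorm_star opnorm_complete.

End OperatorNorm.

(** * Uniqueness of the C*-norm *)

Section StarAlgebras.
Variables (C : numClosedFieldType) (A : starAlgType C).
Implicit Types x y : A.

Lemma star0 : star 0 = 0 :> A.
Proof. by apply: (addIr (star 0)); rewrite -starD !add0r. Qed.

Lemma starN x : star (- x) = - star x.
Proof. by rewrite -!scaleN1r starZ rmorphN1. Qed.

Lemma starB x y : star (x - y) = star x - star y.
Proof. by rewrite starD starN. Qed.

Lemma star1 : star 1 = 1 :> A.
Proof. by rewrite -[LHS]mulr1 -{2}(starK 1) -starM mulr1 starK. Qed.

Lemma star_sum (I : finType) (P : pred I) (F : I -> A) :
  star (\sum_(i | P i) F i) = \sum_(i | P i) star (F i).
Proof. exact: (big_morph _ (@starD _ A) star0). Qed.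

Lemma starX x k : star (x ^+ k) = star x ^+ k.
Proof. by elim: k => [|k IH]; rewrite ?star1 // exprS starM IH -exprSr. Qed.

End StarAlgebras.

Section LinearMaps.
Variables (C : numClosedFieldType) (U V : lmodType C) (f : U -> V).
Hypothesis f_lin : linear f.

Lemma linear_add x y : f (x + y) = f x + f y.
Proof. by have := f_lin 1 x y; rewrite !scale1r. Qed.

Lemma linear_0 : f 0 = 0.
Proof. by apply: (addIr (f 0)); rewrite -linear_add !add0r. Qed.

Lemma linear_scale c x : f (c *: x) = c *: f x.
Proof. by have := f_lin c x 0; rewrite !addr0 linear_0 addr0. Qed.

Lemma linear_opp x : f (- x) = - f x.
Proof. by rewrite -!scaleN1r linear_scale. Qed.

Lemma linear_sub x y : f (x - y) = f x - f y.
Proof. by rewrite linear_add linear_opp. Qed.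

Lemma linear_sumr (I : finType) (P : pred I) (F : I -> U) :
  f (\sum_(i | P i) F i) = \sum_(i | P i) f (F i).
Proof. exact: (big_morph _ linear_add linear_0). Qed.

End LinearMaps.

Lemma is_star_hom_comp (C : numClosedFieldType) (A B D : starAlgType C)
    (f : A -> B) (g : B -> D) :
  is_star_hom f -> is_star_hom g -> is_star_hom (g \o f).
Proof.
case=> fl f1 fM fs [gl g1 gM gs]; split=> /=.
- by move=> c x y /=; rewrite fl gl.
- by rewrite f1 g1.
- by move=> x y /=; rewrite fM gM.
- by move=> x /=; rewrite fs gs.
Qed.

Lemma is_star_hom_id (C : numClosedFieldType) (A : starAlgType C) :
  is_star_hom (@id A).
Proof. by []. Qed.

Section CStarAlgebras.
Variables (R : realType) (A : cstarAlgType R).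
Implicit Types x y : A.

Lemma cnormZ_normc (c : R[i]) x : cnorm (c *: x) = normc c * cnorm x.
Proof. by apply: complexI; rewrite cnormZ complex_normE -rmorphM. Qed.

Lemma cnorm0 : cnorm (0 : A) = 0.
Proof. by rewrite -(scale0r 0) cnormZ_normc normc0 mul0r. Qed.

Lemma cnormN x : cnorm (- x) = cnorm x.
Proof. by rewrite -scaleN1r cnormZ_normc -(opprK 1%R) normcN opprK normc1
  mul1r. Qed.

Lemma cnorm_ge0 x : 0 <= cnorm x.
Proof. by have := cnormD x (- x); rewrite subrr cnorm0 cnormN; lra. Qed.

Lemma cnorm_sum (I : finType) (F : I -> A) :
  cnorm (\sum_i F i) <= \sum_i cnorm (F i).
Proof.
apply: (big_ind2 (fun a b => cnorm a <= b)) => //; first by rewrite cnorm0.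
by move=> a b c d ab cd; apply: le_trans (cnormD _ _) (lerD ab cd).
Qed.

(** The C*-identity iterated by squaring. Along these exponents a constant factor between two norms
    can be absorbed by [le_of_pow2_le]. *)
Lemma cnorm_selfadjoint_pow x k :
  star x = x -> cnorm (x ^+ (2 ^ k)) = cnorm x ^+ (2 ^ k).
Proof.
move=> sx; elim: k => [|k IH]; first by rewrite expn0 !expr1.
rewrite expnS mul2n -addnn [LHS](congr1 _ (exprD _ _ _)).
by rewrite -{1}sx -starX cnorm_star IH -exprM muln2 addnn.
Qed.

Lemma star_mul_eq0 x : star x * x = 0 -> x = 0.
Proof.
move=> x0; apply: cnorm_eq0; apply/eqP; rewrite -sqrf_eq0 -cnorm_star x0.
by rewrite cnorm0.
Qed.

End CStarAlgebras.

(** If [b < a] with [b] positive, Bernoulli's inequality makes the powers of [a / b] exceed any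
    [K]. *)
Lemma le_of_pow2_le (R : realType) (a b K : R) : 0 <= a -> 0 <= b ->
  (forall k, a ^+ (2 ^ k) <= K * b ^+ (2 ^ k)) -> a <= b.
Proof.
move=> a0 b0 hK; rewrite leNgt; apply/negP => ba.
have [b00|bn0] := eqVneq b 0.
  by have := hK 0; rewrite expn0 !expr1 b00 mulr0 -b00 leNgt ba.
have bp : 0 < b by rewrite lt_neqAle eq_sym bn0.
pose d := a / b - 1; have dp : 0 < d by rewrite subr_gt0 ltr_pdivlMr ?mul1r.
have bern k : 1 + k%:R * d <= (a / b) ^+ k.
  elim: k => [|k IH]; first by rewrite mul0r addr0 expr0.
  have -> : a / b = 1 + d by rewrite /d; ring.
  move: IH; rewrite exprS (_ : a / b = 1 + d); last by rewrite /d; ring.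
  move=> IH; apply: (@le_trans _ _ ((1 + d) * (1 + k%:R * d))); last first.
    by rewrite ler_wpM2l // addr_ge0 // ltW.
  rewrite -natr1; have : 0 <= k%:R * (d * d) by rewrite !mulr_ge0 // ltW.
  nra.
have bound k : 1 + k%:R * d <= K.
  apply: (@le_trans _ _ ((a / b) ^+ (2 ^ k))); last first.
    by rewrite expr_div_n ler_pdivrMr ?exprn_gt0.
  apply: le_trans (bern (2 ^ k)%N); rewrite lerD2l ler_wpM2r ?(ltW dp) //.
  by rewrite ler_nat ltnW // ltn_expl.
have K0 : 0 <= K by have := bound 0; rewrite mul0r addr0; lra.
have : K / d < (Num.bound (K / d))%:R.
  by apply: archi_boundP; rewrite divr_ge0 // ltW.
rewrite ltr_pdivrMr // => lt; have := bound (Num.bound (K / d)); lra.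
Qed.

Section GroupBasis.
Variables (C : numClosedFieldType) (G : finGroupType).
Local Notation CG := (galg G C^o).
Implicit Types (g h : G) (x : CG).

Definition delta g : CG := basis_vec C^o g.

Lemma deltaE g h : delta g h = (h == g)%:R.
Proof. by rewrite ffunE. Qed.

Lemma delta1 : delta 1%g = 1.
Proof. by []. Qed.

Lemma delta_mulE g x h : (delta g * x) h = x (g^-1 * h)%g.
Proof.
rewrite ffunE (bigD1 g) //= big1 => [|k kg].
  by rewrite deltaE eqxx mul1r addr0.
by rewrite deltaE (negbTE kg) mul0r.
Qed.

Lemma deltaM g h : delta (g * h)%g = delta g * delta h.
Proof.
apply/ffunP => k; rewrite delta_mulE !deltaE.
by rewrite -[in RHS](inj_eq (mulgI g)) mulKVg.
Qed.

Lemma delta_star g : star (delta g) = delta g^-1%g.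
Proof.
apply/ffunP => k; rewrite galg_conjE !deltaE -(inj_eq invg_inj) invgK.
by rewrite rmorph_nat.
Qed.

Lemma delta_sum x : x = \sum_g x g *: delta g.
Proof.
apply/ffunP => h; rewrite sum_ffunE (bigD1 h) //= big1 => [|k kh].
  by rewrite !ffunE eqxx addr0 [RHS]mulr1.
by rewrite !ffunE eq_sym (negbTE kh) scaler0.
Qed.

Lemma linear_delta (V : lmodType C) (f : CG -> V) x :
  linear f -> f x = \sum_g x g *: f (delta g).
Proof.
move=> fl; rewrite {1}(delta_sum x) (linear_sumr fl).
by apply: eq_bigr => g _; rewrite (linear_scale fl).
Qed.

Lemma linear_delta_ext (V : lmodType C) (f f' : CG -> V) :
  linear f -> linear f' -> (forall g, f (delta g) = f' (delta g)) -> f =1 f'.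
Proof.
move=> fl fl' ff' x; rewrite (linear_delta x fl) (linear_delta x fl').
by apply: eq_bigr => g _; rewrite ff'.
Qed.

Section Lift.
Variables (V : lmodType C) (w : G -> V).

Definition galg_lift x : V := \sum_g x g *: w g.

Lemma galg_lift_linear : linear galg_lift.
Proof.
move=> c x y; rewrite /galg_lift scaler_sumr -big_split /=.
by apply: eq_bigr => g _; rewrite !ffunE scalerDl scalerA.
Qed.

Lemma galg_lift_delta g : galg_lift (delta g) = w g.
Proof.
rewrite /galg_lift (bigD1 g) //= big1 => [|k kg].
  by rewrite deltaE eqxx scale1r addr0.
by rewrite deltaE (negbTE kg) scale0r.
Qed.

End Lift.

Definition unitary_rep (A : starAlgType C) (w : G -> A) : Prop :=
  [/\ w 1%g = 1, forall g h, w (g * h)%g = w g * w h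
    & forall g, star (w g) = w g^-1%g].

Lemma galg_lift_hom (A : starAlgType C) (w : G -> A) :
  unitary_rep w -> is_star_hom (galg_lift w).
Proof.
case=> w1 wM wV; have wl := galg_lift_linear w; split => //.
- by rewrite -delta1 galg_lift_delta.
- move=> x y.
  have xl : linear (fun x => galg_lift w (x * y)).
    by move=> c u v; rewrite mulrDl -scalerAl wl.
  have xl' : linear (fun x => galg_lift w x * galg_lift w y).
    by move=> c u v; rewrite wl mulrDl -scalerAl.
  apply: (linear_delta_ext xl xl') => g {xl xl' x}.
  have yl : linear (fun y => galg_lift w (delta g * y)).
    by move=> c u v; rewrite mulrDr -scalerAr wl.
  have yl' : linear (fun y => galg_lift w (delta g) * galg_lift w y).
    by move=> c u v; rewrite wl mulrDr -scalerAr.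
  apply: (linear_delta_ext yl yl') => h.
  by rewrite -deltaM !galg_lift_delta wM.
- move=> x; rewrite /galg_lift star_sum (reindex_inj invg_inj) /=.
  by apply: eq_bigr => g _; rewrite galg_conjE invgK starZ wV.
Qed.

Lemma unitary_rep_delta (A : starAlgType C) (f : CG -> A) :
  is_star_hom f -> unitary_rep (f \o delta).
Proof.
case=> fl f1 fM fs; split=> /=; first by rewrite delta1.
  by move=> g h; rewrite deltaM fM.
by move=> g; rewrite -fs delta_star.
Qed.

End GroupBasis.

Section NormUniqueness.
Variables (R : realType) (G : finGroupType).
Local Notation CG := (galg G R[i]^o).
Local Notation delta := (@delta R[i] G).

(* The matrix of left multiplication by [c] has trace [#|G| * c 1], and its
   eigenvalues are bounded by any submultiplicative norm of [c]. *)
Lemma normc_coef1_le (T : cstarAlgType R) (f : CG -> T) (c : CG) :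
  is_star_hom f -> injective f -> normc (c 1%g) <= cnorm (f c).
Proof.
move=> [fl f1 fM fs] finj.
pose M : 'M[R[i]]_#|G| := \matrix_(i, j) c (enum_val j * (enum_val i)^-1)%g.
have n0 : (0 < #|G|)%N by apply/card_gt0P; exists 1%g.
have trM : \tr M = #|G|%:R * c 1%g.
  rewrite /mxtrace; under eq_bigr => i _ do rewrite mxE mulgV.
  by rewrite sumr_const card_ord mulr_natl.
have eigM a : root (char_poly M) a -> normc a <= cnorm (f c).
  rewrite -eigenvalue_root_char => /eigenvalueP[v vM v0].
  pose y : CG := [ffun g => v 0 (enum_rank g)].
  have cy : c * y = a *: y.
    apply/ffunP => h; have := congr1 (fun u : 'rV_#|G| => u 0 (enum_rank h)) vM.
    rewrite !mxE => vMh; rewrite !ffunE; apply: (etrans _ vMh).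
    rewrite (reindex (fun i : 'I_#|G| => h * (enum_val i)^-1)%g) /=; last first.
      exists (fun x => enum_rank (x^-1 * h)%g) => x _.
        by rewrite invMg invgK mulgKV enum_valK.
      by rewrite enum_rankK invMg invgK mulKVg.
    apply: eq_bigr => i _; rewrite mxE enum_rankK !ffunE invMg invgK mulgKV.
    by rewrite enum_valK mulrC.
  have fy0 : cnorm (f y) != 0.
    apply: contra_neq v0 => /cnorm_eq0; rewrite -(linear_0 fl) => /finj y0.
    apply/rowP => i; have := congr1 (fun u : CG => u (enum_val i)) y0.
    by rewrite !ffunE enum_valK mxE.
  have yp : 0 < cnorm (f y) by rewrite lt_neqAle eq_sym fy0 cnorm_ge0.
  by rewrite -(ler_pM2r yp) -cnormZ_normc -(linear_scale fl) -cy fM cnormM.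
have [r Dr] := closed_field_poly_normal (char_poly M).
rewrite (monicP (char_poly_monic M)) scale1r in Dr.
have sr : size r = #|G|.
  by apply/eqP; rewrite -eqSS -(size_prod_XsubC _ id) -Dr size_char_poly.
(* The trace is minus the subleading coefficient of the characteristic polynomial, hence the sum of
   its roots with multiplicity. *)
have : #|G|%:R * c 1%g = \sum_(a <- r) a.
  apply: oppr_inj; rewrite -trM -char_poly_trace // Dr -{1}sr.
  by rewrite coefPn_prod_XsubC // sr -lt0n.
have np : (0 : R) < #|G|%:R by rewrite ltr0n.
move=> /(congr1 (@normc R)); rewrite normcM => E.
rewrite -(ler_pM2l np) -[leLHS](_ : normc (#|G|%:R) * normc (c 1%g) = _);
  last first.
  congr (_ * _); apply: complexI; rewrite -complex_normE normr_nat.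
  by rewrite rmorph_nat.
rewrite E {E trM}.
have : forall a, a \in r -> normc a <= cnorm (f c).
  by move=> a ar; apply: eigM; rewrite Dr root_prod_XsubC.
rewrite -sr; elim: (r) => [|a s IH] hs; first by rewrite big_nil normc0 mul0r.
rewrite big_cons /= -natr1 mulrDl mul1r [leRHS]addrC.
apply: le_trans (le_normcD _ _) (lerD _ _); first by apply: hs;
  rewrite inE eqxx.
by apply: IH => b bs; apply: hs; rewrite inE bs orbT.
Qed.

(** Multiplication by [delta g^-1] moves the coefficient at [g] to the neutral element. *)
Lemma normc_coef_le (T : cstarAlgType R) (f : CG -> T) (c : CG) g :
  is_star_hom f -> injective f ->
  normc (c g) <= cnorm (f (delta g^-1)) * cnorm (f c).
Proof.
move=> fh finj; have := normc_coef1_le (delta g^-1%g * c) fh finj.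
rewrite delta_mulE invgK mulg1 => /le_trans; apply.
by have [_ _ -> _] := fh; exact: cnormM.
Qed.

(** The norm pulled back along an injective [f'] controls all coefficients, hence every other such
    norm up to a constant [K]. On the powers of c^* c with exponent 2^k both norms are
    multiplicative, and [K] disappears. Only [f'] has to be injective. *)
Lemma cstar_norm_unique (T T' : cstarAlgType R) (f : CG -> T) (f' : CG -> T')
    (c : CG) :
  is_star_hom f -> is_star_hom f' -> injective f' ->
  cnorm (f c) <= cnorm (f' c).
Proof.
move=> fh fh' finj'; have [fl f1 fM fs] := fh; have [fl' f1' fM' fs'] := fh'.
pose K := \sum_g cnorm (f (delta g)) * cnorm (f' (delta g^-1)).
have hK x : cnorm (f x) <= K * cnorm (f' x).
  rewrite (linear_delta x fl); apply: le_trans (cnorm_sum _) _.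
  rewrite mulr_suml; apply: ler_sum => g _; rewrite cnormZ_normc mulrC -mulrA.
  by rewrite ler_wpM2l ?cnorm_ge0 ?normc_coef_le.
rewrite -(ler_pXn2r (n := 2)) ?nnegrE ?cnorm_ge0 // -!cnorm_star.
rewrite -fs -fM -fs' -fM'; set s := star c * c.
have ss : star s = s by rewrite /s (starM (star c) c) starK.
have pw (D : cstarAlgType R) (h : CG -> D) k : is_star_hom h ->
    cnorm (h s) ^+ (2 ^ k) = cnorm (h (s ^+ (2 ^ k))).
  case=> hl h1 hM hs; rewrite -cnorm_selfadjoint_pow -?hs ?ss //; congr cnorm.
  by elim: (2 ^ k)%N => [|m IH]; rewrite ?expr0 // !exprS IH hM.
apply: (@le_of_pow2_le _ _ _ K); rewrite ?cnorm_ge0 // => k.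
by rewrite (pw _ f) // (pw _ f').
Qed.

End NormUniqueness.

(** * Tensor products of group algebras *)

Lemma lin_span_sum (C : numClosedFieldType) (V : lmodType C) (P : V -> Prop)
    (J : finType) (c : J -> C) (u : J -> V) :
  (forall j, P (u j)) -> lin_span P (\sum_j c j *: u j).
Proof.
move=> Pu; exists #|J|, (c \o enum_val), (u \o enum_val); split=> [i|].
  exact: Pu.
by rewrite -(big_enum_val (fun j => c j *: u j)); apply: eq_bigl.
Qed.

Lemma cstar_denseT (R : realType) (A : cstarAlgType R) (P : A -> Prop) :
  (forall x, P x) -> cstar_dense P.
Proof. by move=> PT x e e0; exists x => //; rewrite subrr cnorm0. Qed.

Section TensorFacts.
Variables (R : realType) (A B T : cstarAlgType R) (t : A -> B -> T).
Hypothesis tP : is_cstar_tensor t.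

Lemma tensor_linl b : linear (t^~ b). Proof. by case: tP => [[]]. Qed.
Lemma tensor_linr a : linear (t a). Proof. by case: tP => [[]]. Qed.

Lemma tensor1 : t 1 1 = 1. Proof. by case: tP => [_ []]. Qed.

Lemma tensorM a a' b b' : t (a * a') (b * b') = t a b * t a' b'.
Proof. by case: tP => [_ []]. Qed.

Lemma tensor_star a b : t (star a) (star b) = star (t a b).
Proof. by case: tP => [_ []]. Qed.

Lemma tensor0l b : t 0 b = 0. Proof. exact: linear_0 (tensor_linl b). Qed.
Lemma tensor0r a : t a 0 = 0. Proof. exact: linear_0 (tensor_linr a). Qed.

Lemma tensorDl a a' b : t (a + a') b = t a b + t a' b.
Proof. exact: linear_add (tensor_linl b) _ _. Qed.
Lemma tensorDr a b b' : t a (b + b') = t a b + t a b'.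
Proof. exact: linear_add (tensor_linr a) _ _. Qed.

End TensorFacts.

Section GroupTensor.
Variables (R : realType) (G H T : finGroupType).
Variables (phi : T -> G * H) (phi' : G * H -> T).
Hypotheses (phiK : cancel phi phi') (phi'K : cancel phi' phi).
Hypothesis phiM : {morph phi : x y / (x * y)%g >-> (x * y)%g}.
Local Notation CG := (galg G R[i]^o).
Local Notation CH := (galg H R[i]^o).
Local Notation CT := (galg T R[i]^o).

(** The isomorphism [phi] is a parameter so that one group algebra can carry both bracketings of a
    triple tensor product, as [coassociative] asks: [phi] is the identity for one and [assoc] for
    the other. *)
Definition galg_tens (a : CG) (b : CH) : CT :=
  [ffun p => a (phi p).1 * b (phi p).2].

Lemma phi1 : phi 1%g = 1%g.
Proof. by apply: (mulgI (phi 1%g)); rewrite -phiM !mulg1. Qed.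

Lemma phiV p : phi p^-1%g = (phi p)^-1%g.
Proof. by apply: (mulgI (phi p)); rewrite -phiM !mulgV phi1. Qed.

Lemma galg_tensE a b p : galg_tens a b p = a (phi p).1 * b (phi p).2.
Proof. by rewrite ffunE. Qed.

Lemma galg_tens_linl b : linear (galg_tens^~ b).
Proof.
by move=> c x y; apply/ffunP => p; rewrite !ffunE mulrDl -scalerAl.
Qed.

Lemma galg_tens_linr a : linear (galg_tens a).
Proof. by move=> c x y; apply/ffunP => p; rewrite !ffunE mulrDr -scalerAr. Qed.

Lemma galg_tens_delta g h :
  galg_tens (delta R[i] g) (delta R[i] h) = delta R[i] (phi' (g, h)).
Proof.
apply/ffunP => p; rewrite galg_tensE !deltaE -natrM mulnb.
by rewrite -(can2_eq phiK phi'K) [phi p in RHS]surjective_pairing xpair_eqE.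
Qed.

Lemma galg_tensM a a' b b' :
  galg_tens (a * a') (b * b') = galg_tens a b * galg_tens a' b'.
Proof.
apply/ffunP => z; rewrite galg_tensE !galg_mulE big_distrlr /=.
rewrite pair_big /= (reindex phi) /=; last by exists phi' => ? _.
apply: eq_bigr => p _; rewrite !galg_tensE mulrACA.
by rewrite phiM phiV.
Qed.

Lemma galg_tens_star a b :
  galg_tens (star a) (star b) = star (galg_tens a b).
Proof.
apply/ffunP => z; rewrite galg_tensE !galg_conjE galg_tensE rmorphM.
by rewrite phiV.
Qed.

Lemma galg_tens1 : galg_tens 1 1 = 1.
Proof.
by rewrite -!delta1 galg_tens_delta; congr (delta _ _); rewrite -[RHS]phiK phi1.
Qed.

Lemma galg_tens_sum (x : CT) :
  x = \sum_p x p *: galg_tens (delta R[i] (phi p).1) (delta R[i] (phi p).2).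
Proof.
rewrite {1}(delta_sum x); apply: eq_bigr => p _.
by rewrite galg_tens_delta -surjective_pairing phiK.
Qed.

Lemma galg_tens_span x : lin_span (fun z => exists a b, z = galg_tens a b) x.
Proof. by rewrite (galg_tens_sum x); apply: lin_span_sum => p;
  do 2 eexists. Qed.

Lemma galg_tens_cstar_tensor : is_cstar_tensor galg_tens.
Proof.
split; [|split| |exact: cstar_denseT galg_tens_span].
- by split; [exact: galg_tens_linl|exact: galg_tens_linr].
- exact: galg_tens1.
- exact: galg_tensM.
- exact: galg_tens_star.
(* For fixed [h], the coefficients at all [(g, h)] form a linear relation between the [a i] with
   scalars [b i h]. *)
move=> k a b ind ab0 i; apply/ffunP => h; rewrite ffunE.
apply: (ind (fun i => b i h)); apply/ffunP => g.
have := congr1 (fun x : CT => x (phi' (g, h))) ab0.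
rewrite sum_ffunE [X in _ = X -> _]ffunE => E.
rewrite sum_ffunE [RHS]ffunE -[RHS]E; apply: eq_bigr => j _.
by rewrite galg_tensE phi'K ffunE [LHS]mulrC.
Qed.

Section Hom.
Variables (B1 B2 B : cstarAlgType R) (t : B1 -> B2 -> B).
Variables (f1 : CG -> B1) (f2 : CH -> B2).
Hypothesis tP : is_cstar_tensor t.
Hypotheses (f1P : is_star_hom f1) (f2P : is_star_hom f2).

Definition galg_tens_hom : CT -> B :=
  galg_lift (fun p => t (f1 (delta R[i] (phi p).1)) (f2 (delta R[i] (phi
    p).2))).

Lemma galg_tens_homP : is_tensor_hom galg_tens t f1 f2 galg_tens_hom.
Proof.
have [w1 wM wV] := unitary_rep_delta f1P;
  have [v1 vM vV] := unitary_rep_delta f2P.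
split.
  apply: galg_lift_hom; split => [|p q|p].
  - by rewrite phi1 (w1 : f1 _ = 1) (v1 : f2 _ = 1) tensor1.
  - by rewrite phiM -tensorM //; congr t; [exact: wM|exact: vM].
  - by rewrite -tensor_star // phiV; congr t; [exact: wV|exact: vV].
have [fl1 _ _ _] := f1P; have [fl2 _ _ _] := f2P.
have Fl : linear galg_tens_hom := galg_lift_linear _.
move=> a b.
have al : linear (fun a => galg_tens_hom (galg_tens a b)).
  by move=> c x y; rewrite galg_tens_linl Fl.
have al' : linear (fun a => t (f1 a) (f2 b)).
  by move=> c x y; rewrite fl1 (tensor_linl tP).
apply: (linear_delta_ext al al') => g {al al' a}.
have bl : linear (fun b => galg_tens_hom (galg_tens (delta R[i] g) b)).
  by move=> c x y; rewrite galg_tens_linr Fl.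
have bl' : linear (fun b => t (f1 (delta R[i] g)) (f2 b)).
  by move=> c x y; rewrite fl2 (tensor_linr tP).
apply: (linear_delta_ext bl bl') => h {bl bl' b}.
by rewrite galg_tens_delta /galg_tens_hom galg_lift_delta phi'K.
Qed.

End Hom.

End GroupTensor.

(** Every model of the tensor product receives a *-homomorphism from C[G x H], injective by the
    independence clause of [is_cstar_tensor]. By [cstar_norm_unique] all models then induce the same
    norm. *)
Lemma cstar_tensor_group_min (R : realType) (G H : finGroupType)
    (T : cstarAlgType R) (t : galg G R[i]^o -> galg H R[i]^o -> T) :
  is_cstar_tensor t -> is_min_tensor t.
Proof.
move=> tP; split=> // T' t' tP' k a b.
have idK : cancel (@id (G * H)) id by [].
have idM : {morph (@id (G * H)) : x y / (x * y)%g >-> (x * y)%g} by [].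
pose E (S : cstarAlgType R) (s : galg G R[i]^o -> galg H R[i]^o -> S) :=
  galg_tens_hom (@id (G * H)) s id id.
have EP (S : cstarAlgType R) s : is_cstar_tensor s ->
    is_tensor_hom (galg_tens (@id (G * H))) s id id (E S s).
  move=> sP; apply: (galg_tens_homP idK idK idM sP); exact: is_star_hom_id.
have Esum (S : cstarAlgType R) s : is_cstar_tensor s ->
    \sum_i s (a i) (b i) = E S s (\sum_i galg_tens (@id (G * H)) (a i) (b i)).
  move=> /EP [[El _ _ _] hE]; rewrite (linear_sumr El).
  by apply: eq_bigr => i _; rewrite hE.
rewrite (Esum T t) // (Esum T' t') //.
have [Eh _] := EP T t tP; have [Eh' E'e] := EP T' t' tP'.
apply: cstar_norm_unique => //.
have [El' _ _ _] := Eh'.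
suff inj0 x : E T' t' x = 0 -> x = 0.
  by move=> x y xy; apply/eqP; rewrite -subr_eq0; apply/eqP/inj0;
    rewrite (linear_sub El') xy subrr.
move=> Ex0; case: (tP') => _ _ ind _.
pose c g : galg H R[i]^o := [ffun h => x (g, h)].
have cE g h : c g h = x (g, h) by rewrite ffunE.
have : \sum_(i < #|G|) t' (delta R[i] (enum_val i)) (c (enum_val i)) = 0.
  rewrite -(big_enum_val (fun g => t' (delta R[i] g) (c g))) -[RHS]Ex0.
  have -> : E T' t' x =
      \sum_g \sum_h x (g, h) *: t' (delta R[i] g) (delta R[i] h).
    by rewrite pair_bigA; apply: eq_bigr => -[].
  apply: eq_bigr => g _; rewrite (linear_delta (c g) (tensor_linr tP' _)).
  by apply: eq_bigr => h _; rewrite cE.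
move=> /(ind _ (fun i => delta R[i] (enum_val i))) c0.
apply/ffunP => -[g h]; rewrite -cE -(enum_rankK g) c0 ?ffunE //.
move=> d d0 i; have := congr1 (fun y : galg G R[i]^o => y (enum_val i)) d0.
rewrite sum_ffunE (bigD1 i) //= big1 => [|j ji].
  by rewrite !ffunE eqxx addr0 [X in X = _ -> _]mulr1.
rewrite !ffunE (inj_eq enum_val_inj) eq_sym (negbTE ji); exact: scaler0.
Qed.

(** * The quantum group on two copies of a group algebra *)

Lemma half_double (F : numFieldType) (V : lmodType F) (v : V) :
  2^-1 *: (v + v) = v.
Proof. by rewrite scalerDr -scalerDl -[2^-1]mul1r -splitr scale1r. Qed.

(* [C[S x Z_2]] is [C[S] (+) C[S]]: with [eps] the generator of [Z_2], the copy
   of [g] in the summand [b] is [g (1 + (-1)^b eps) / 2]. *)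
HB.lock Definition copy (R : realType) (S : finGroupType) (b : bool) (g : S) :
    galg (S * 'Z_2)%type R[i]^o :=
  2^-1 *: (delta R[i] ((g, 0) : S * 'Z_2) +
           (-1) ^+ b *: delta R[i] ((g, 1) : S * 'Z_2)).

Lemma negb_eqb_id (b : bool) : (~~ b == b) = false.
Proof. by case: b. Qed.

Section DoubleGroupAlgebra.
Variables (R : realType) (S : finGroupType).
Local Notation Gam := (S * 'Z_2)%type.
Local Notation K := (galg Gam R[i]^o).
Implicit Types (g h : S) (b c : bool).
Local Notation copy := (@copy R S).

Lemma delta_copy g (k : 'Z_2) :
  delta R[i] ((g, k) : Gam) = copy false g + (-1) ^+ k *: copy true g.
Proof.
rewrite !copy.unlock expr0 expr1 scale1r scaleN1r; case: k => [[|[|//]] ltk].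
  rewrite expr0 scale1r (_ : Ordinal ltk = 0); last exact: val_inj.
  by rewrite -scalerDr addrACA subrr addr0 half_double.
rewrite expr1 scaleN1r -scalerN -scalerDr opprB [_ - delta _ _]addrC addrACA.
by rewrite subrr add0r half_double; congr (delta _ (_, _)); apply: val_inj.
Qed.

(** The character by which Z_2 acts on the summand [b]. *)
Definition sgn b (k : 'Z_2) : R[i] := if b then (-1) ^+ (k : nat) else 1.

Lemma delta_copy_sum (p : Gam) : delta R[i] p = \sum_b sgn b p.2 *: copy b p.1.
Proof. by case: p => g k; rewrite big_bool /= scale1r addrC -delta_copy. Qed.

Lemma copyM b c g h :
  copy b g * copy c h = if b == c then copy b (g * h)%g else 0.
Proof.
have dM (j k l : 'Z_2) : (j * k)%g = l ->
    delta R[i] ((g, j) : Gam) * delta R[i] ((h, k) : Gam) =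
    delta R[i] (((g * h)%g, l) : Gam).
  by move=> <-; rewrite -deltaM.
rewrite !copy.unlock -scalerAl -scalerAr mulrDl !mulrDr -!scalerAl -!scalerAr.
rewrite (dM 0 0 0) ?(dM 0 1 1) ?(dM 1 0 1) ?(dM 1 1 0); try exact: val_inj.
move: (delta _ _) (delta _ _) => x y.
case: b c => [] [] /=; rewrite ?expr0 ?expr1 ?scale1r ?scaleN1r ?opprK.
- by rewrite [- x + y]addrC half_double.
- by rewrite -[- x - y]opprD [y + x]addrC subrr !scaler0.
- by rewrite -[x - y]opprB subrr !scaler0.
- by rewrite [x + y]addrC half_double.
Qed.

Lemma copy1 : copy false 1%g + copy true 1%g = 1.
Proof.
by rewrite -delta1; have := delta_copy 1%g 0; rewrite expr0 scale1r => <-.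
Qed.

Lemma copy_star b g : star (copy b g) = copy b g^-1%g.
Proof.
rewrite !copy.unlock starZ starD starZ !delta_star fmorphV rmorph_nat
  rmorph_sign.
by congr (_ *: (delta _ (_, _) + _ *: delta _ (_, _))); apply: val_inj.
Qed.

(** Neither [w b] is unital in general: the elements [w false 1] and [w true 1] are complementary
    projections. *)
Definition double_rep (A : starAlgType R[i]) (w : bool -> S -> A) : Prop :=
  [/\ w false 1%g + w true 1%g = 1,
      forall b c g h, w b g * w c h = if b == c then w b (g * h)%g else 0
    & forall b g, star (w b g) = w b g^-1%g].

Lemma copy_double_rep : double_rep copy.
Proof. by split; [exact: copy1|exact: copyM|exact: copy_star]. Qed.

Lemma double_rep_comp (A B : starAlgType R[i]) (w : bool -> S -> A) (f : A ->
  B) :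
  double_rep w -> is_star_hom f -> double_rep (fun b g => f (w b g)).
Proof.
case=> w1 wM ws [fl f1 fM fs]; split; first by rewrite -(linear_add fl) w1.
  by move=> b c g h; rewrite -fM wM; case: ifP => // _; rewrite (linear_0 fl).
by move=> b g; rewrite -fs ws.
Qed.

Definition double_lift (A : starAlgType R[i]) (w : bool -> S -> A) : K -> A :=
  galg_lift (fun p : Gam => w false p.1 + (-1) ^+ (p.2 : nat) *: w true p.1).

Section DoubleLift.
Variables (A : starAlgType R[i]) (w : bool -> S -> A).

Lemma double_lift_copy b g : double_lift w (copy b g) = w b g.
Proof.
have l := galg_lift_linear
  (fun p : Gam => w false p.1 + (-1) ^+ (p.2 : nat) *: w true p.1).
rewrite /double_lift !copy.unlock (linear_scale l) (linear_add l) (linear_scale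
  l).
rewrite !galg_lift_delta /= expr0 expr1 scale1r scaleN1r.
case: b; last by rewrite expr0 scale1r addrACA subrr addr0 half_double.
by rewrite expr1 scaleN1r opprB [w true g - _]addrC addrACA subrr add0r
  half_double.
Qed.

Lemma double_lift_hom : double_rep w -> is_star_hom (double_lift w).
Proof.
case=> w1 wM ws; apply: galg_lift_hom; split.
- by rewrite expr0 scale1r.
- move=> [g j] [h k] /=.
  rewrite mulrDl !mulrDr -!scalerAl -!scalerAr !wM /= !scaler0 addr0 add0r
    scalerA.
  congr (_ + _ *: _).
  by case: j k => [[|[|//]] ?] [[|[|//]] ?];
    rewrite /= ?expr0 ?expr1 ?mulr1 ?mul1r ?mulN1r ?opprK.
- move=> [g k] /=; rewrite starD starZ !ws rmorph_sign; congr (_ + _ *: _).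
  by case: k => [[|[|//]] ?].
Qed.

End DoubleLift.

Lemma double_ext (V : lmodType R[i]) (f f' : K -> V) :
  linear f -> linear f' -> (forall b g, f (copy b g) = f' (copy b g)) -> f =1
    f'.
Proof.
move=> fl fl' ff'; apply: linear_delta_ext => // -[g k].
rewrite delta_copy (linear_add fl) (linear_add fl').
by rewrite (linear_scale fl) (linear_scale fl') !ff'.
Qed.

Variable theta : S -> S.
Hypotheses (thetaM : {morph theta : g h / (g * h)%g >-> (g * h)%g})
  (thetaK : involutive theta).

Lemma theta1 : theta 1%g = 1%g.
Proof. by apply: (mulgI (theta 1%g)); rewrite -thetaM !mulg1. Qed.

Lemma thetaV g : theta g^-1%g = (theta g)^-1%g.
Proof. by apply: (mulgI (theta g)); rewrite -thetaM !mulgV theta1. Qed.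

Local Notation K2 := (galg (Gam * Gam)%type R[i]^o).
Local Notation K3 := (galg (Gam * Gam * Gam)%type R[i]^o).
Local Notation t := (@galg_tens R Gam Gam (Gam * Gam)%type id).

Lemma idK (T : Type) : cancel (@id T) id. Proof. by []. Qed.
Lemma idM (T : finGroupType) : {morph (@id T) : x y / (x * y)%g >-> (x * y)%g}.
Proof. by []. Qed.

Lemma double_tensP : is_cstar_tensor t.
Proof. exact: galg_tens_cstar_tensor (@idK _) (@idK _) (@idM _). Qed.

Let tM := tensorM double_tensP.

(** With [false] for sigma and [true] for tau, these are the formulas of the theorem, extended from
    the generators to the whole group. *)
Definition comul_copy b g : K2 :=
  t (copy false g) (copy b g) + t (copy true g) (copy (~~ b) (theta g)).

Lemma comul_copy_rep : double_rep comul_copy.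
Proof.
split.
- rewrite /comul_copy theta1 addrACA [X in _ + X]addrC -!(tensorDr
  double_tensP).
  by rewrite copy1 -(tensorDl double_tensP) copy1 (tensor1 double_tensP).
- move=> b c g h; rewrite /comul_copy mulrDl !mulrDr -!tM !copyM /= thetaM.
  rewrite !(tensor0l double_tensP) addr0 add0r (inj_eq negb_inj).
  by case: ifP => // _; rewrite !(tensor0r double_tensP) addr0.
- move=> b g; rewrite /comul_copy starD -!(tensor_star double_tensP) !copy_star.
  by rewrite thetaV.
Qed.

Definition double_comul : K -> K2 := double_lift comul_copy.

Lemma double_comul_copy b g : double_comul (copy b g) = comul_copy b g.
Proof. exact: double_lift_copy. Qed.

Lemma double_comul_hom : is_star_hom double_comul.
Proof. exact/double_lift_hom/comul_copy_rep. Qed.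

Definition assoc (p : Gam * Gam * Gam) : Gam * (Gam * Gam) := (p.1.1, (p.1.2,
  p.2)).
Definition assoc' (p : Gam * (Gam * Gam)) : Gam * Gam * Gam := (p.1, p.2.1,
  p.2.2).

Lemma assocK : cancel assoc assoc'. Proof. by case=> [[]]. Qed.
Lemma assoc'K : cancel assoc' assoc. Proof. by case=> ? []. Qed.
Lemma assocM : {morph assoc : x y / (x * y)%g >-> (x * y)%g}.
Proof. by case=> [[? ?] ?] [[? ?] ?]. Qed.

Lemma double_coassoc : coassociative t double_comul.
Proof.
pose tl := @galg_tens R (Gam * Gam)%type Gam (Gam * Gam * Gam)%type id.
pose tr := @galg_tens R Gam (Gam * Gam)%type (Gam * Gam * Gam)%type assoc.
have tlP : is_cstar_tensor tl.
  exact: galg_tens_cstar_tensor (@idK _) (@idK _) (@idM _).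
have trP : is_cstar_tensor tr.
  exact: galg_tens_cstar_tensor assocK assoc'K assocM.
have tlr x y z : tl (t x y) z = tr x (t y z).
  by apply/ffunP => p; rewrite !ffunE [RHS]mulrA.
exists K3, tl, tr; split=> //; try exact: cstar_tensor_group_min.
have LP := galg_tens_homP (@idK _) (@idK _) (@idM _) tlP double_comul_hom
  (is_star_hom_id K).
have RP := galg_tens_homP (@idK _) (@idK _) (@idM _) trP (is_star_hom_id K)
  double_comul_hom.
exists (galg_tens_hom id tl double_comul id), (galg_tens_hom id tr id
  double_comul).
split; [exact: LP|exact: RP|move=> a].
have [[Ll _ _ _] LE] := LP; have [[Rl _ _ _] RE] := RP.
have [Dl _ _ _] := double_comul_hom.
apply: (double_ext (f := fun a => galg_tens_hom id tl double_comul id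
  (double_comul a))
  (f' := fun a => galg_tens_hom id tr id double_comul (double_comul a))).
- by move=> k x y; rewrite Dl Ll.
- by move=> k x y; rewrite Dl Rl.
move=> b g; rewrite double_comul_copy /comul_copy.
rewrite (linear_add Ll) (linear_add Rl) !LE !RE !double_comul_copy /comul_copy.
(* Both sides consist of the same four terms. In the term with [copy true] in the first two legs,
   the right side carries [theta (theta g)] and a double negation. *)
rewrite !(tensorDl tlP) !(tensorDr trP) !tlr thetaK negbK.
by rewrite -!addrA; congr (_ + _); rewrite addrC -addrA.
Qed.

Lemma lin_span_double_tens (P : K2 -> Prop) (x : K2) :
  (forall b c g h, P (t (copy b g) (copy c h))) -> lin_span P x.
Proof.
move=> Pcopy.
pose u (j : (Gam * Gam) * (bool * bool)) : K2 :=
  t (copy j.2.1 j.1.1.1) (copy j.2.2 j.1.2.1).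
pose a (j : (Gam * Gam) * (bool * bool)) : R[i] :=
  x j.1 * (sgn j.2.1 j.1.1.2 * sgn j.2.2 j.1.2.2).
have -> : x = \sum_j a j *: u j.
  rewrite -(pair_bigA _ (fun p bb => a (p, bb) *: u (p, bb))) /=.
  rewrite {1}(galg_tens_sum (@idK _) (@idK _) x); apply: eq_bigr => p _.
  rewrite -(pair_bigA _ (fun b c => a (p, (b, c)) *: u (p, (b, c)))) /=.
  rewrite !delta_copy_sum (linear_sumr (tensor_linl double_tensP _))
    scaler_sumr.
  apply: eq_bigr => b _; rewrite (linear_sumr (tensor_linr double_tensP _)).
  rewrite scaler_sumr; apply: eq_bigr => c _.
  rewrite (linear_scale (tensor_linl double_tensP _)).
  by rewrite (linear_scale (tensor_linr double_tensP _)) !scalerA.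
by apply: lin_span_sum => j; exact: Pcopy.
Qed.

(** Multiplying one leg by an element of a single copy keeps one of the two terms of [comul_copy],
    and the group element of that factor is chosen to correct the leg. So every product of two
    copies is attained, without closure; the same holds for [double_density_r]. *)
Lemma double_density_l : cstar_dense (lin_span
  (fun z : K2 => exists x y, z = double_comul x * t y 1)).
Proof.
apply: cstar_denseT => x; apply: lin_span_double_tens => b c g h; case: b.
  exists (copy (~~ c) (theta h)), (copy true ((theta h)^-1 * g)%g).
  rewrite double_comul_copy /comul_copy mulrDl -!tM !mulr1 !copyM /=.
  by rewrite thetaK mulKVg (tensor0l double_tensP) add0r negbK.
exists (copy c h), (copy false (h^-1 * g)%g).
rewrite double_comul_copy /comul_copy mulrDl -!tM !mulr1 !copyM /=.
by rewrite mulKVg (tensor0l double_tensP) addr0.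
Qed.

Lemma double_density_r : cstar_dense (lin_span
  (fun z : K2 => exists x y, z = double_comul x * t 1 y)).
Proof.
apply: cstar_denseT => x; apply: lin_span_double_tens => b c g h; case: b.
  exists (copy (~~ c) g), (copy c ((theta g)^-1 * h)%g).
  rewrite double_comul_copy /comul_copy mulrDl -!tM !mulr1 !copyM negbK eqxx.
  by rewrite mulKVg negb_eqb_id (tensor0r double_tensP) add0r.
exists (copy c g), (copy c (g^-1 * h)%g).
rewrite double_comul_copy /comul_copy mulrDl -!tM !mulr1 !copyM eqxx.
by rewrite mulKVg negb_eqb_id (tensor0r double_tensP) addr0.
Qed.

Definition double_cqg : compact_quantum_group R := CompactQuantumGroup
  (cstar_tensor_group_min double_tensP) double_comul_hom double_coassoc
  double_density_l double_density_r.

End DoubleGroupAlgebra.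

(** * Matrices indexed by a path *)

Lemma mulr_mid (A : pzRingType) (x x' y y' : A) :
  (x * x') * (y * y') = x * (x' * y) * y'.
Proof. by rewrite !mulrA. Qed.

Section PathMatrix.
Variables (R : realType) (A : cstarAlgType R) (N : nat).
Implicit Types (q : 'I_N -> 'I_N -> A) (i j k l : 'I_N).

Definition adj i k : bool := (i.+1 == k :> nat) || (k.+1 == i :> nat).

(** The relations of a quantum symmetry of the path with [N] vertices, with signs allowed: the
    squares of the entries, rather than the entries, sum to [1]. *)
Definition path_matrix q : Prop :=
  [/\ forall j i, star (q j i) = q j i,
      forall i, \sum_j q j i * q j i = 1,
      forall j, \sum_i q j i * q j i = 1
    & forall j l i k, adj i k != adj j l -> q j i * q l k = 0].

Lemma path_matrix_tr q : path_matrix q -> path_matrix (fun j i => q i j).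
Proof.
case=> qs qc qr qadj; split=> // j l i k; rewrite eq_sym; exact: qadj.
Qed.

Lemma path_matrix_expand q j i k : path_matrix q -> adj i k ->
  q j i = \sum_(l | adj j l) q j i * (q l k * q l k).
Proof.
case=> _ qc _ qadj aik; rewrite -[LHS]mulr1 -(qc k) mulr_sumr.
rewrite (bigID (adj j)) /= [X in _ + X]big1 ?addr0 // => l nadj.
by rewrite mulrA qadj ?mul0r // aik (negbTE nadj).
Qed.

(* Expanding [q j i] along the column of a neighbour of [i] leaves one term;
   expanding it along the row [j'] leaves two such terms, so
   [q j i = q j i + q j i]. *)
Lemma path_matrix_step q j i j' i1 i2 : path_matrix q ->
  adj j j' -> adj i i1 -> adj i i2 -> i1 != i2 ->
  (forall k, adj i k -> k = i1 \/ k = i2) ->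
  (forall l k, adj j l -> l != j' -> adj i k -> q l k = 0) ->
  q j i = 0.
Proof.
move=> qP ajj' ai1 ai2 i12 iE q0.
have term k : adj i k -> q j i = q j i * (q j' k * q j' k).
  move=> aik; rewrite {1}(path_matrix_expand j qP aik) (bigD1 j') //=.
  rewrite big1 ?addr0 // => l /andP[ajl lj'].
  by rewrite (q0 l k) // !mulr0.
have := path_matrix_expand i (path_matrix_tr qP) ajj'.
rewrite (bigD1 i1) //= (bigD1 i2) /= ?ai2 1?eq_sym // big1 ?addr0; last first.
  by move=> k /andP[/andP[/iE[] ->]]; rewrite ?eqxx.
by rewrite -!term // => /eqP; rewrite -subr_eq0 opprD addNKr oppr_eq0 => /eqP.
Qed.

Definition end_dist i : nat := minn i (rev_ord i).

(** Induction on [end_dist j]. The index [i] is interior and has two neighbours. Every neighbour of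
    [j] except the inward one [j'] is closer to an end than [j], so by induction its entries against
    the neighbours of [i] vanish, which is the situation of [path_matrix_step]. *)
Lemma path_matrix_end_dist q j i : path_matrix q ->
  (end_dist j < end_dist i)%N -> q j i = 0.
Proof.
move=> qP; move: {-1}(end_dist j) (erefl (end_dist j)) => m.
elim/ltn_ind: m j i => m IH j i dj di.
have [i0 i1] : (0 < i)%N /\ (i.+1 < N)%N.
  by move: di; rewrite /end_dist /=; have := ltn_ord i; lia.
have ip : (i.-1 < N)%N by lia.
have [j' ajj' j'E] : exists2 j' : 'I_N, adj j j' & forall l, adj j l -> l != j'
  ->
    (end_dist l < m)%N.
  have jN := ltn_ord j; have iN := ltn_ord i.
  have [jl|jr] := leqP j (rev_ord j).
    have jS : (j.+1 < N)%N by move: di dj jl; rewrite /end_dist /=; lia.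
    exists (Ordinal jS) => [|l]; first by rewrite /adj /= eqxx.
    rewrite -val_eqE /adj /= => ajl lj; have := ltn_ord l.
    by move: dj jl; rewrite /end_dist /=; lia.
  have jp : (j.-1 < N)%N by lia.
  exists (Ordinal jp) => [|l]; first by move: jr; rewrite /adj /=; lia.
  rewrite -val_eqE /adj /= => ajl lj; have := ltn_ord l.
  by move: dj jr; rewrite /end_dist /=; lia.
apply: (@path_matrix_step q j i j' (Ordinal ip) (Ordinal i1)) => //.
- by rewrite /adj /=; lia.
- by rewrite /adj /= eqxx.
- by rewrite -val_eqE /=; lia.
- move=> k; rewrite /adj => /orP[/eqP|/eqP] kE; [right|left];
  apply: val_inj => /=; lia.
- move=> l k ajl lj' aik; apply: (IH (end_dist l)) => //; first exact: j'E.
  have := j'E l ajl lj'; move: di aik; rewrite /end_dist /adj /=.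
  have := ltn_ord i; have := ltn_ord k; lia.
Qed.

Lemma path_matrix_pattern q j i : path_matrix q ->
  j != i -> j != rev_ord i -> q j i = 0.
Proof.
move=> qP; rewrite -!val_eqE /= => ji jr.
have : (end_dist j < end_dist i)%N \/ (end_dist i < end_dist j)%N.
  by rewrite /end_dist /=; have := ltn_ord i; have := ltn_ord j; lia.
case; first exact: path_matrix_end_dist.
exact: path_matrix_end_dist (path_matrix_tr qP).
Qed.

(** * The projection that splits a path matrix *)

Section Projection.
Variable q : 'I_N -> 'I_N -> A.
Hypotheses (N_gt1 : (1 < N)%N) (qP : path_matrix q).
Hypothesis braid : forall i c, adj i c -> rev_ord c = c ->
  q i i * q c c * q (rev_ord i) i = 0.

Let qs j i : star (q j i) = q j i. Proof. by case: qP. Qed.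
Let q0 j i : j != i -> j != rev_ord i -> q j i = 0.
Proof. exact: path_matrix_pattern. Qed.
Let qadj j l i k : adj i k != adj j l -> q j i * q l k = 0.
Proof. by case: qP => _ _ _; apply. Qed.

Local Notation r := (fun i => q i i * q i i).
Local Notation off i := (rev_ord i != i).

Let col_sum i : off i -> r i + q (rev_ord i) i * q (rev_ord i) i = 1.
Proof.
move=> ni; case: qP => _ /(_ i) <- _ _.
rewrite (bigD1 i) //= (bigD1 (rev_ord i)) //= big1 ?addr0 // => j /andP[ji jr].
by rewrite q0 // mul0r.
Qed.

Let row_sum i : off i -> r i + q i (rev_ord i) * q i (rev_ord i) = 1.
Proof.
move=> ni; case: qP => _ _ /(_ i) <- _.
rewrite (bigD1 i) //= (bigD1 (rev_ord i)) //= big1 ?addr0 // => j /andP[ji jr].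
by rewrite q0 ?mul0r // 1?eq_sym // (can2_eq (@rev_ordK _) (@rev_ordK _)).
Qed.

Let mid_sqr c : rev_ord c = c -> q c c * q c c = 1.
Proof.
move=> mc; case: qP => _ /(_ c) <- _ _.
rewrite (bigD1 c) //= big1 ?addr0 // => j jc.
by rewrite q0 ?mul0r ?mc.
Qed.

(** As neither index is the middle one, [i] is not adjacent to [rev_ord k]. Hence [r i] annihilates
    [1 - r k] and [1 - r i] annihilates [r k], which makes both equal to [r i * r k]. *)
Let r_adj i k : off i -> off k -> adj i k -> r i = r k /\ r i * r k = r i.
Proof.
move=> ni nk aik.
have nr : ~~ adj i (rev_ord k) && ~~ adj (rev_ord i) k.
  move: ni nk aik; rewrite -!val_eqE /adj /=.
  by have := ltn_ord i; have := ltn_ord k; lia.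
have ab : q i i * q (rev_ord k) k = 0.
  by apply: qadj; rewrite aik; case/andP: nr => /negbTE->.
have ba : q (rev_ord i) i * q k k = 0.
  by apply: qadj; rewrite aik; case/andP: nr => _ /negbTE->.
have ri : r i = r i * r k.
  rewrite -[LHS]mulr1 -(col_sum nk) mulrDr.
  by rewrite (mulr_mid _ _ (q (rev_ord k) k)) ab mulr0 mul0r addr0.
have rk : r k = r i * r k.
  rewrite -[LHS]mul1r -(col_sum ni) mulrDl.
  by rewrite (mulr_mid (q (rev_ord i) i)) ba mulr0 mul0r addr0.
by split=> //; rewrite [LHS]ri -rk.
Qed.

(** Row [i] and column [rev_ord i] share their off-diagonal entry. *)
Let r_rev i : off i -> r (rev_ord i) = r i.
Proof.
move=> ni; apply: (addIr (q i (rev_ord i) * q i (rev_ord i))).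
rewrite row_sum // -[RHS](col_sum (i := rev_ord i)) ?rev_ordK // eq_sym //.
Qed.

Let star_r i : star (r i) = r i.
Proof. by rewrite starM qs. Qed.

(** The braid hypothesis gives [r i * q c c * (1 - r i) = 0]. Comparing with the adjoint yields
    commutation, and cancelling [q c c], whose square is [1], yields idempotence. *)
Let r_mid i c : adj i c -> rev_ord c = c ->
  r i * q c c = q c c * r i /\ r i * r i = r i.
Proof.
move=> aic mc; have ni : off i.
  move: aic (congr1 val mc); rewrite -!val_eqE /adj /=.
  by have := ltn_ord i; have := ltn_ord c; lia.
have bb : q (rev_ord i) i * q (rev_ord i) i = 1 - r i.
  by rewrite -(col_sum ni) addrC addKr.
have rc1 : r i * q c c * (1 - r i) = 0.
  by rewrite -bb -(mulrA _ (q i i)) mulr_mid braid // mulr0 mul0r.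
have rc : r i * q c c = r i * q c c * r i.
  by apply/eqP; rewrite -subr_eq0 -{1}[r i * q c c]mulr1 -mulrBr rc1.
have cr : q c c * r i = r i * q c c * r i.
  have := congr1 (@star _ A) rc.
  by rewrite !starM !qs mulrA => ->; rewrite !mulrA.
split; first by rewrite rc -cr.
have : q c c * (r i * (1 - r i)) = 0 by rewrite mulrA cr -rc.
move=> /(congr1 (fun x => q c c * x)); rewrite mulrA mid_sqr // mul1r mulr0.
by rewrite mulrBr mulr1 => /eqP; rewrite subr_eq0 => /eqP.
Qed.

Let N_gt0 : (0 < N)%N. Proof. exact: ltnW. Qed.
Let p := r (Ordinal N_gt0).

Let off0 : off (Ordinal N_gt0).
Proof. by rewrite -val_eqE /=; lia. Qed.

(** By [r_rev] it suffices to walk from the end through the first half of the path, where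
    consecutive indices satisfy [r_adj] and the middle is never met. *)
Let r_p i : off i -> r i = p.
Proof.
wlog il : i / (i < rev_ord i)%N.
  move=> W ni; have [|rl] := ltnP i (rev_ord i); first by move=> ?; exact: W.
  rewrite -r_rev //; apply: W; last by rewrite rev_ordK eq_sym.
  by rewrite rev_ordK ltn_neqAle rl andbT.
case: i il => i; elim: i => [|i IH] iN il ni.
  by congr r; apply: val_inj.
have iN' : (i < N)%N by exact: ltnW.
have ni' : off (Ordinal iN') by move: il; rewrite -!val_eqE /=; lia.
rewrite -(IH iN') //; last by move: il => /=; lia.
have [] := @r_adj (Ordinal iN') (Ordinal iN) => //.
by rewrite /adj /= eqxx.
Qed.

Let p_idem : p * p = p.
Proof.
(* For [N = 3] the only neighbour of the end is the middle index, so [r_adj] does not apply and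
   idempotence comes from the braid relation. *)
have [N3|N3] := eqVneq N 3.
  have [//||_ ->//] := @r_mid (Ordinal N_gt0) (Ordinal N_gt1).
  by apply: val_inj => /=; lia.
have n1 : off (Ordinal N_gt1) by rewrite -val_eqE /=; lia.
have [//|rr] := @r_adj (Ordinal N_gt0) (Ordinal N_gt1) off0 n1.
by rewrite -rr.
Qed.

Let star_p : star p = p. Proof. exact: star_r. Qed.

Let p1p : p * (1 - p) = 0. Proof. by rewrite mulrBr mulr1 p_idem subrr. Qed.

(** By the C*-identity, since [(1 - p) * r i * (1 - p)] vanishes; [antidiag] follows in the same way
    from [p * (1 - p) = 0]. *)
Let diag i : off i -> q i i * p = q i i.
Proof.
move=> ni; have : q i i * (1 - p) = 0.
  apply: star_mul_eq0; rewrite starM starB star1 star_p qs mulr_mid.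
  by rewrite r_p // mulrBl mul1r p_idem subrr mul0r.
by rewrite mulrBr mulr1 => /eqP; rewrite subr_eq0 => /eqP <-.
Qed.

Let antidiag i : off i -> q (rev_ord i) i * p = 0.
Proof.
move=> ni; apply: star_mul_eq0; rewrite starM star_p qs mulr_mid.
rewrite (_ : q _ _ * q _ _ = 1 - p); last first.
  by rewrite -(r_p ni) -(col_sum ni) addrC addKr.
by rewrite p1p mul0r.
Qed.

Let diag' i : off i -> p * q i i = q i i.
Proof. by move=> /diag/(congr1 (@star _ A)); rewrite starM star_p qs. Qed.

Let antidiag' i : off i -> p * q (rev_ord i) i = 0.
Proof. by move=> /antidiag/(congr1 (@star _ A));
  rewrite starM star_p qs star0. Qed.

Let mid_comm c : rev_ord c = c -> p * q c c = q c c * p.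
Proof.
move=> mc; have cE := congr1 val mc; rewrite /= in cE.
have cN := ltn_ord c; have iN : (c.-1 < N)%N by lia.
have ai : adj (Ordinal iN) c by rewrite /adj /=; lia.
have ni : off (Ordinal iN) by rewrite -val_eqE /=; lia.
by have [+ _] := r_mid ai mc; rewrite r_p.
Qed.

Lemma path_matrix_projection : exists p : A, [/\ star p = p, p * p = p,
  forall j i, p * q j i = q j i * p,
  forall j i, j != i -> p * q j i = 0
  & forall j i, j != rev_ord i -> (1 - p) * q j i = 0].
Proof.
exists p; split=> // [j i|j i ji|j i jr].
- have [<-|ji] := eqVneq j i.
    have [mj|nj] := eqVneq (rev_ord j) j; first exact: mid_comm.
    by rewrite diag // diag'.
  have [jr|jr] := eqVneq j (rev_ord i); last by rewrite q0 // mulr0 mul0r.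
  by rewrite jr antidiag ?antidiag' // -jr.
- have [jr|jr] := eqVneq j (rev_ord i); last by rewrite q0 // mulr0.
  by rewrite jr antidiag' // -jr.
- have [ji|ji] := eqVneq j i; last by rewrite q0 // mulr0.
  by rewrite ji mulrBl mul1r diag' ?subrr // eq_sym -{1}ji.
Qed.

End Projection.

End PathMatrix.

(** * Words of length two in the symmetric group *)

Section CoxeterWords.
Variable n : nat.
Local Notation I := 'I_n.-1.
Implicit Types (i j k l a b : I) (x y g h : 'S_n).

(** The transposition s_i on all natural numbers, so that equations between words become linear
    arithmetic with case distinctions. *)
Definition swap (i x : nat) : nat :=
  if x == i then i.+1 else if x == i.+1 then i else x.

Lemma sgenE i (z : 'I_n) : sgen i z = swap i z :> nat.
Proof.
rewrite /sgen /swap; case: tpermP => [->|->|/eqP + /eqP +] /=.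
- by rewrite eqxx.
- by rewrite eqxx; case: eqP => //; lia.
- by rewrite -!val_eqE /= => /negbTE -> /negbTE ->.
Qed.

Lemma sgenV i : ((sgen i)^-1 = sgen i)%g. Proof. exact: tpermV. Qed.

Lemma sgenK i : (sgen i * sgen i = 1)%g. Proof. by rewrite -{1}sgenV mulVg. Qed.

Lemma sgen_inj : injective (@sgen n).
Proof.
move=> i k /(congr1 (fun s : 'S_n => val (s (Ordinal (lower_proof i))))) /=.
rewrite !sgenE /= /swap eqxx => H; apply: val_inj => /=; move: H.
by repeat case: eqP => ?; lia.
Qed.

Lemma sgen_neq1 i : sgen i != 1%g.
Proof.
apply/eqP => /(congr1 (fun s : 'S_n => val (s (Ordinal (lower_proof i))))) /=.
by rewrite sgenE perm1 /swap /= eqxx; lia.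
Qed.

Lemma sgen_mul_eval i k a b :
  (sgen a * sgen b = sgen i * sgen k)%g ->
  forall z, (z < n)%N -> swap b (swap a z) = swap k (swap i z).
Proof.
move=> E z zn.
have := congr1 (fun s : 'S_n => val (s (Ordinal zn))) E.
by rewrite /= !permM !sgenE.
Qed.

Lemma sgen_mul_eq1 i k : (sgen i * sgen k == 1)%g = (i == k).
Proof. by rewrite -{1}(sgenV k) -eq_mulgV1 (inj_eq sgen_inj). Qed.

Lemma swap_spec (i z : nat) :
  z = i /\ swap i z = i.+1 \/ z = i.+1 /\ swap i z = i \/
  (z <> i /\ z <> i.+1) /\ swap i z = z.
Proof. by rewrite /swap; case: eqP => [->|zi]; last case: eqP => [->|];
  lia. Qed.

Lemma swap_min (i k : nat) : i != k -> swap k (swap i (minn i k)) != minn i k.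
Proof. by have := swap_spec i (minn i k);
  have := swap_spec k (swap i (minn i k)); lia. Qed.

Lemma swap_lt_min (i k z : nat) : (z < minn i k)%N -> swap k (swap i z) = z.
Proof. by have := swap_spec i z; have := swap_spec k (swap i z); lia. Qed.

Lemma swap_max (i k : nat) : i != k ->
  swap k (swap i (maxn i k).+1) != (maxn i k).+1.
Proof. by have := swap_spec i ((maxn i k).+1);
  have := swap_spec k (swap i ((maxn i k).+1)); lia. Qed.

Lemma swap_gt_max (i k z : nat) : ((maxn i k).+1 < z)%N -> swap k (swap i z) =
  z.
Proof. by have := swap_spec i z; have := swap_spec k (swap i z); lia. Qed.

(* The least and the largest point moved by [s_i s_k] determine [{i, k}]. *)
Lemma sgen_mul_eq i k a b : i != k ->
  (sgen a * sgen b = sgen i * sgen k)%g -> (a = i /\ b = k) \/ (a = k /\ b = i).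
Proof.
move=> ik E; have ab : a != b.
  by rewrite -sgen_mul_eq1 E sgen_mul_eq1.
have ev := sgen_mul_eval E.
have [[[i1 k1] a1] b1] := (upper_proof i, upper_proof k, upper_proof a,
  upper_proof b).
rewrite -!val_eqE /= in ik ab.
have mn : minn a b = minn i k.
  apply/eqP; rewrite eqn_leq; apply/andP; split; rewrite leqNgt;
    apply/negP => lt.
    by have := swap_min ik; rewrite -ev ?(swap_lt_min lt) ?eqxx //; lia.
  by have := swap_min ab; rewrite ev ?(swap_lt_min lt) ?eqxx //; lia.
have mx : maxn a b = maxn i k.
  apply/eqP; rewrite eqn_leq; apply/andP; split; rewrite leqNgt;
    apply/negP => lt.
    by have := swap_max ab; rewrite ev ?(@swap_gt_max i k) ?eqxx ?ltnS //; lia.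
  by have := swap_max ik; rewrite -ev ?(@swap_gt_max a b) ?eqxx ?ltnS //; lia.
have : ((a : nat) = i /\ (b : nat) = k) \/ ((a : nat) = k /\ (b : nat) = i) by
  lia.
by case=> [] [/val_inj-> /val_inj->]; [left|right].
Qed.

Lemma sgen_adj_noncomm i k : adj i k -> (sgen k * sgen i != sgen i * sgen k)%g.
Proof.
rewrite /adj => aik; apply/eqP => /sgen_mul_eval ev.
have [i1 k1] := (upper_proof i, upper_proof k).
case/orP: aik => /eqP e.
  have := ev i (ltnW i1); have := swap_spec i i; have := swap_spec k (swap i i);
  by have := swap_spec k i; have := swap_spec i (swap k i); lia.
have := ev k (ltnW k1); have := swap_spec i k; have := swap_spec k (swap i k);
by have := swap_spec k k; have := swap_spec i (swap k k); lia.
Qed.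

Lemma sgen_far_comm i k : i != k -> ~~ adj i k ->
  (sgen k * sgen i = sgen i * sgen k)%g.
Proof.
rewrite -val_eqE /adj /= => ik nik; apply/permP => z; apply: val_inj.
rewrite /= !permM !sgenE.
by have := swap_spec i z; have := swap_spec k (swap i z);
  have := swap_spec k z; have := swap_spec i (swap k z); lia.
Qed.

Lemma sgen_braid i k : adj i k ->
  (sgen i * sgen k * sgen i = sgen k * sgen i * sgen k)%g.
Proof.
rewrite /adj /= => aik; apply/permP => z; apply: val_inj.
rewrite /= !permM !sgenE.
have := swap_spec i z; have := swap_spec k (swap i z).
have := swap_spec i (swap k (swap i z)).
case/orP: aik => /eqP ik; have := swap_spec k z; have := swap_spec i (swap k z);
  have := swap_spec k (swap i (swap k z)); lia.
Qed.

Lemma ell_word x : is_word x (ell x).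
Proof. by rewrite /ell; case: ex_minnP. Qed.

Lemma ell_le x (m : nat) : is_word x m -> (ell x <= m)%N.
Proof. by rewrite /ell; case: ex_minnP => p _; apply. Qed.

Lemma ell1 : ell (1%g : 'S_n) = 0%N.
Proof.
apply/eqP; rewrite -leqn0. apply: ell_le; apply/is_wordP.
by exists [::]; rewrite ?big_nil.
Qed.

Lemma ell_eq0 x : ell x = 0%N -> x = 1%g.
Proof.
move=> x0; have := ell_word x; rewrite x0 => /is_wordP[[|//] _ <-].
by rewrite big_nil.
Qed.

Lemma ell_sgen i : ell (sgen i) = 1%N.
Proof.
apply/eqP; rewrite eqn_leq; apply/andP; split.
  by apply: ell_le; apply/is_wordP; exists [:: i]; rewrite ?big_seq1.
rewrite lt0n; apply/eqP => /ell_eq0/eqP; exact/negP/sgen_neq1.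
Qed.

Lemma ell_eq1 x : ell x = 1%N -> exists i, x = sgen i.
Proof.
move=> x1; have := ell_word x; rewrite x1 => /is_wordP[[|i [|//]] // _ <-].
by exists i; rewrite big_seq1.
Qed.

Lemma thetaM : {morph @theta n : x y / (x * y)%g >-> (x * y)%g}.
Proof. by move=> x y; rewrite /theta conjMg. Qed.

Lemma thetaK : involutive (@theta n).
Proof.
move=> x; rewrite /theta -conjgM (_ : reversal n * reversal n = 1)%g ?conjg1 //.
by apply/permP => z; rewrite permM !permE rev_ordK.
Qed.

(** [theta] permutes the generators, so it maps words to words of the same length. *)
Lemma ell_theta_le x : (ell (theta x) <= ell x)%N.
Proof.
have /is_wordP[w sw wx] := ell_word x; rewrite -sw; apply: ell_le;
  apply/is_wordP.
exists (map (@rev_ord _) w); first by rewrite size_map.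
rewrite -wx big_map {sw wx}; elim: w => [|i w IH].
  by rewrite !big_nil /theta conj1g.
by rewrite !big_cons thetaM theta_sgen IH.
Qed.

Lemma ell_theta x : ell (theta x) = ell x.
Proof. by apply/eqP; rewrite eqn_leq ell_theta_le -{1}[x]thetaK ell_theta_le.
  Qed.

Lemma sgen_ind (P : 'S_n -> Prop) :
  P 1%g -> (forall i, P (sgen i)) -> (forall x y, P x -> P y -> P (x * y)%g) ->
  forall x, P x.
Proof.
move=> P1 Ps PM x; have /is_wordP[w _ <-] := ell_word x.
by elim: w => [|i w IH]; rewrite ?big_nil ?big_cons //; apply: PM.
Qed.

End CoxeterWords.

(** * Coefficient matrices that respect the length *)

Section GradedMatrix.
Variables (R : realType) (n : nat) (A : cstarAlgType R).
Implicit Types (u : 'S_n -> 'S_n -> A) (i j k l : 'I_n.-1) (g h x : 'S_n).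

(** The third condition is multiplicativity of the coaction and the fourth is its transpose.
    Including both makes the notion stable under transposition, so that each statement about columns
    also serves for rows. *)
Definition graded_matrix u : Prop :=
  [/\ u 1%g 1%g = 1,
      forall h g, star (u h g) = u h^-1%g g^-1%g,
      forall h g g', u h (g * g')%g = \sum_x u x g * u (x^-1 * h)%g g',
      forall h h' g, u (h * h')%g g = \sum_x u h x * u h' (x^-1 * g)%g
    & forall h g, ell h != ell g -> u h g = 0].

Lemma graded_matrix_tr u : graded_matrix u -> graded_matrix (fun h g => u g h).
Proof. by case=> u1 us ud uc ul; split=> // h g; rewrite eq_sym; exact: ul. Qed.

Local Notation gen u := (fun j i => u (sgen j) (sgen i)).

Lemma big_sgen (F : 'S_n -> A) : (forall x, ell x != 1%N -> F x = 0) ->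
  \sum_x F x = \sum_i F (sgen i).
Proof.
move=> F0; rewrite (bigID (mem [set sgen i | i : 'I_n.-1])) /=.
rewrite [X in _ + X]big1 => [|x xs].
  rewrite addr0 big_imset /=; last by move=> i k _ _ /sgen_inj.
  by apply: eq_bigl => i; rewrite inE.
apply: F0; apply: contra xs => /eqP/ell_eq1[i ->].
exact: imset_f.
Qed.

Lemma graded_mulr u h i g : graded_matrix u ->
  u h (sgen i * g)%g = \sum_j u (sgen j) (sgen i) * u (sgen j * h)%g g.
Proof.
case=> _ _ ud _ ul; rewrite ud big_sgen => [|x x1].
  by apply: eq_bigr => j _; rewrite sgenV.
by rewrite ul ?mul0r // ell_sgen.
Qed.

Lemma graded_mull u h j g : graded_matrix u ->
  u (sgen j * h)%g g = \sum_i u (sgen j) (sgen i) * u h (sgen i * g)%g.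
Proof. by move=> /graded_matrix_tr uP; exact: graded_mulr uP. Qed.

Lemma graded_gen_eq0 u j x : graded_matrix u ->
  (forall i, x != sgen i) -> u (sgen j) x = 0.
Proof.
case=> _ _ _ _ ul xs; apply: ul; rewrite ell_sgen eq_sym; apply/eqP => x1.
by have [i xi] := ell_eq1 x1; have := xs i; rewrite xi eqxx.
Qed.

(** For adjacent indices s_i s_k factors into two generators in only one way, so a single term of
    the expansion survives. In [graded_dual_far] the generators commute and two terms survive. *)
Lemma graded_dual_adj u j l i k : graded_matrix u -> adj i k ->
  u (sgen j * sgen l)%g (sgen i * sgen k)%g =
  u (sgen j) (sgen i) * u (sgen l) (sgen k).
Proof.
move=> uP aik; rewrite graded_mull // (bigD1 i) //= mulgA sgenK mul1g.
rewrite big1 ?addr0 // => a ai; rewrite [X in _ * X](graded_gen_eq0 _ uP)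
  ?mulr0 // => b.
apply/eqP => E; have ik : i != k by move: aik; rewrite -val_eqE /adj /=; lia.
have : (sgen a * sgen b = sgen i * sgen k)%g by rewrite -E mulgA sgenK mul1g.
move=> ab; case: (sgen_mul_eq ik ab) => [[aE _]|[aE bE]].
  by rewrite aE eqxx in ai.
by move/eqP: ab; rewrite aE bE; apply/negP/sgen_adj_noncomm.
Qed.

Lemma graded_dual_far u j l i k : graded_matrix u -> i != k -> ~~ adj i k ->
  u (sgen j * sgen l)%g (sgen i * sgen k)%g =
  u (sgen j) (sgen i) * u (sgen l) (sgen k) +
  u (sgen j) (sgen k) * u (sgen l) (sgen i).
Proof.
move=> uP ik nik; rewrite graded_mull // (bigD1 i) //= (bigD1 k) /=; last first.
  by rewrite eq_sym.
rewrite mulgA sgenK mul1g -{1}(sgen_far_comm ik nik) mulgA sgenK mul1g.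
rewrite big1 ?addr0 // => a /andP[ai ak].
rewrite [X in _ * X](graded_gen_eq0 _ uP) ?mulr0 // => b; apply/eqP => E.
have : (sgen a * sgen b = sgen i * sgen k)%g by rewrite -E mulgA sgenK mul1g.
by case/(sgen_mul_eq ik) => [] [aE _]; rewrite aE eqxx in ai ak.
Qed.

(** If [j = l], the two words have different lengths. Otherwise s_j and s_l commute: one expansion
    of the entry at (s_j s_l, s_i s_k) has two terms, and by the other expansion each term equals
    this entry, which is therefore twice itself. *)
Lemma graded_gen_orth u j l i k : graded_matrix u -> adj i k -> ~~ adj j l ->
  u (sgen j) (sgen i) * u (sgen l) (sgen k) = 0.
Proof.
move=> uP aik njl; rewrite -graded_dual_adj //.
have [jl|jl] := eqVneq j l.
  rewrite jl sgenK; case: uP => _ _ _ _; apply.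
  rewrite ell1 eq_sym; apply/eqP => /ell_eq0/eqP; rewrite sgen_mul_eq1.
  by move: aik; rewrite -val_eqE /adj /=; lia.
have := graded_dual_far i k (graded_matrix_tr uP) jl njl.
rewrite -graded_dual_adj // -(graded_dual_adj l j uP aik).
rewrite (sgen_far_comm jl njl) => /eqP.
by rewrite -subr_eq0 opprD addNKr oppr_eq0 => /eqP.
Qed.

Lemma graded_path_matrix u : graded_matrix u -> path_matrix (gen u).
Proof.
move=> uP; have uP' := graded_matrix_tr uP; have [u1 us _ _ _] := uP; split.
- by move=> j i; rewrite us !sgenV.
- move=> i; rewrite -[RHS]u1 -[X in _ = u _ X](sgenK i) graded_mulr //.
  by apply: eq_bigr => j _; rewrite mulg1.
- move=> j; rewrite -[RHS]u1 -[X in _ = u X _](sgenK j) graded_mull //.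
  by apply: eq_bigr => i _; rewrite mulg1.
- move=> j l i k; have [aik|nik] := boolP (adj i k) => ajl.
    by apply: graded_gen_orth => //; rewrite eq_sym eqb_id in ajl.
  by apply: (graded_gen_orth uP') => //; move: ajl;
    rewrite eq_sym eqbF_neg negbK.
Qed.

End GradedMatrix.

(** * The matrix of an isometric coaction *)

Section GradedProjection.
Variables (R : realType) (n : nat) (A : cstarAlgType R).
Variable u : 'S_n -> 'S_n -> A.
Hypotheses (n_gt2 : (2 < n)%N) (uP : graded_matrix u).
Implicit Types (i j k l c : 'I_n.-1) (g h x : 'S_n).

Lemma graded_sgen_eq0 h i :
  h != sgen i -> h != sgen (rev_ord i) -> u h (sgen i) = 0.
Proof.
move=> hi hr; have [/ell_eq1[j hj]|h1] := eqVneq (ell h) 1%N; last first.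
  by case: uP => _ _ _ _; apply; rewrite ell_sgen.
rewrite hj; apply: (path_matrix_pattern (graded_path_matrix uP)).
  by move: hi; rewrite hj; apply: contra_neq => ->.
by move: hr; rewrite hj; apply: contra_neq => ->.
Qed.

Lemma sgen_word5_eval a b c d e (z : nat) (zn : (z < n)%N) :
  val ((sgen a * (sgen b * (sgen c * (sgen d * sgen e))))%g (Ordinal zn)) =
  swap e (swap d (swap c (swap b (swap a z)))).
Proof. by rewrite /= !permM !sgenE. Qed.

(** These exclusions remove the unwanted terms in [graded_mid_braid]. The image of one point, [i] or
    [i + 1] according to the direction of the path, already tells the permutations apart. *)
Lemma sgen_path_words i c k : adj i c -> adj c k -> i != k ->
  let h := (sgen i * (sgen c * sgen k))%g in
  [/\ (sgen c * (sgen k * h) != sgen i)%g, (sgen c * (sgen k * h) != sgen k)%g,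
      (sgen i * (sgen c * h) != sgen c)%g & (sgen k * (sgen c * h) != sgen
        c)%g].
Proof.
rewrite /adj -val_eqE => aic ack ik.
have neq (m : nat) : (((m.+1 == m) = false) * ((m == m.+1) = false) *
    ((m.+2 == m) = false) * ((m == m.+2) = false) * ((m.+3 == m) = false) *
    ((m == m.+3) = false))%type by repeat split; lia.
have ev z (zn : (z < n)%N) (x y : 'S_n) : x = y ->
    val (x (Ordinal zn)) = val (y (Ordinal zn)) by move->.
case/orP: aic => /eqP ic.
- have [c' k'] : (c : nat) = i.+1 /\ (k : nat) = i.+2 by move: ack ik => /=;
  lia.
  split; apply/eqP => /(ev _ (ltnW (upper_proof i)));
    rewrite sgen_word5_eval /= sgenE /= k' c' {ev ack ik ic c' k'};
    by rewrite /swap ?(eqxx, eqSS, neq) /= ?(eqxx, eqSS, neq) /= ?(eqxx, eqSS,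
      neq) /=; lia.
- have [c' i'] : (c : nat) = k.+1 /\ (i : nat) = k.+2 by move: ack ik => /=;
  lia.
  split; apply/eqP => /(ev _ (upper_proof i));
    rewrite sgen_word5_eval /= sgenE /= i' c' {ev ack ik ic c' i'};
    by rewrite /swap ?(eqxx, eqSS, neq) /= ?(eqxx, eqSS, neq) /= ?(eqxx, eqSS,
      neq) /=; lia.
Qed.

Lemma graded_mid_braid i c : adj i c -> rev_ord c = c ->
  u (sgen i) (sgen i) * u (sgen c) (sgen c) * u (sgen (rev_ord i)) (sgen i) = 0.
Proof.
move=> aic mc; set k := rev_ord i.
have ki : k != i.
  by move: aic (congr1 val mc); rewrite -val_eqE /adj /k /=;
    have := ltn_ord i; have := ltn_ord c; lia.
have ack : adj c k.
  by move: aic (congr1 val mc); rewrite /adj /k /=;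
    have := ltn_ord i; have := ltn_ord c; lia.
have pat := @path_matrix_pattern _ _ _ _ _ _ (graded_path_matrix uP).
have exp_i h g : u h (sgen i * g)%g =
    u (sgen i) (sgen i) * u (sgen i * h)%g g + u (sgen k) (sgen i) * u (sgen k
      * h)%g g.
  rewrite graded_mulr // (bigD1 i) //= (bigD1 k) //= big1 ?addr0 // => j
    /andP[ji jk].
  by rewrite (pat j i) // mul0r.
have exp_c h g : u h (sgen c * g)%g = u (sgen c) (sgen c) * u (sgen c * h)%g g.
  rewrite graded_mulr // (bigD1 c) //= big1 ?addr0 // => j jc.
  by rewrite (pat j c) ?mul0r // mc.
have [w1 w2 w3 w4] := sgen_path_words aic ack (contra_neq esym ki).
(* In this row, the expansion of s_i s_c s_i keeps only the term whose last factor is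
   [u (sgen k) (sgen i)], and that of s_c s_i s_c keeps none. *)
have := congr1 (u (sgen i * (sgen c * sgen k))%g) (sgen_braid aic).
rewrite -!mulgA !exp_i !exp_c exp_i.
have -> : (sgen c * (sgen i * (sgen i * (sgen c * sgen k))))%g = sgen k.
  by rewrite (mulgA (sgen i)) sgenK mul1g mulgA sgenK mul1g.
rewrite (graded_sgen_eq0 w1 w2) !mulr0 addr0.
rewrite (@graded_sgen_eq0 _ c w3) ?mc // (@graded_sgen_eq0 _ c w4) ?mc //.
by rewrite !mulr0 addr0 mulr0 mulrA.
Qed.

Lemma graded_eq0_1 h : h != 1%g -> u h 1%g = 0.
Proof.
move=> h1; case: uP => _ _ _ _; apply; rewrite ell1.
by apply: contra_neq h1 => /ell_eq0.
Qed.

Lemma graded_projection : exists p : A, [/\ star p = p, p * p = p,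
  forall h g, p * u h g = u h g * p,
  forall h g, h != g -> p * u h g = 0
  & forall h g, h != theta g -> (1 - p) * u h g = 0].
Proof.
have N1 : (1 < n.-1)%N by move: n_gt2; lia.
have [p [ps pp pc p0 p1]] :=
  path_matrix_projection N1 (graded_path_matrix uP) graded_mid_braid.
have u1 : u 1%g 1%g = 1 by case: uP.
have uM h x y : u h (x * y)%g = \sum_z u z x * u (z^-1 * h)%g y by case: uP.
exists p; suff H g : [/\ forall h, p * u h g = u h g * p,
    forall h, h != g -> p * u h g = 0
    & forall h, h != theta g -> (1 - p) * u h g = 0].
  by split=> // h g; have [? ? ?] := H g; auto.
(* In the expansion of [u h (x * y)], multiplication by [p] leaves only the term [z = x], and by
   [1 - p] only [z = theta x]; commutation then passes the projection on to the factor at [y]. *)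
elim/sgen_ind: g => [|i|x y [xc x0 x1] [yc y0 y1]].
- split=> h; last 2 first.
  + by move/graded_eq0_1->; rewrite mulr0.
  + by rewrite /theta conj1g => /graded_eq0_1->; rewrite mulr0.
  have [->|/graded_eq0_1->] := eqVneq h 1%g; last by rewrite mulr0 mul0r.
  by rewrite u1 mulr1 mul1r.
- have ul h : (exists j, h = sgen j) \/ u h (sgen i) = 0.
    have [h1|h1] := eqVneq (ell h) 1%N; [left; exact: ell_eq1|right].
    by case: uP => _ _ _ _; apply; rewrite ell_sgen.
  split=> h; case: (ul h) => [[j ->]|->]; rewrite ?mulr0 ?mul0r //.
    by move=> ji; apply: p0; apply: contra_neq ji => ->.
  by rewrite theta_sgen => ji; apply: p1; apply: contra_neq ji => ->.
split=> h.
- rewrite uM mulr_sumr mulr_suml; apply: eq_bigr => z _.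
  by rewrite mulrA xc -mulrA yc mulrA.
- move=> hxy; rewrite uM mulr_sumr big1 // => z _; rewrite mulrA.
  have [zx|zx] := eqVneq z x; last by rewrite x0 // mul0r.
  rewrite xc -mulrA y0 ?mulr0 //; apply: contra_neq hxy => <-.
  by rewrite zx mulKVg.
- move=> hxy; rewrite uM mulr_sumr big1 // => z _; rewrite mulrA.
  have [zx|zx] := eqVneq z (theta x); last by rewrite x1 // mul0r.
  have xc1 : (1 - p) * u z x = u z x * (1 - p) by rewrite mulrBl mulrBr xc
    mul1r mulr1.
  rewrite xc1 -mulrA y1 ?mulr0 //; apply: contra_neq hxy => hE.
  by rewrite thetaM -hE zx mulKVg.
Qed.

Definition twist (b : bool) g := if b then theta g else g.

Lemma twistM b : {morph twist b : g h / (g * h)%g >-> (g * h)%g}.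
Proof. by case: b => //; exact: thetaM. Qed.

Lemma twistK b : involutive (twist b).
Proof. by case: b => //; exact: thetaK. Qed.

Lemma twist1 b : twist b 1%g = 1%g.
Proof. by case: b; rewrite //= /theta conj1g. Qed.

Lemma twistV b g : twist b g^-1%g = (twist b g)^-1%g.
Proof. by case: b; rewrite //= /theta conjVg. Qed.

Lemma graded_double_rep : exists w : bool -> 'S_n -> A,
  double_rep w /\ forall h g, u h g = \sum_b (h == twist b g)%:R *: w b h.
Proof.
have [p [ps pp pc p0 p1]] := graded_projection.
pose e (b : bool) := if b then 1 - p else p.
have es b : star (e b) = e b by case: b; rewrite /= ?starB ?star1 ps.
have eM (b c : bool) : e b * e c = if b == c then e b else 0.
  by case: b c => [] [] /=; rewrite ?mulrBl ?mulrBr ?mul1r ?mulr1 ?pp ?subrr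
    ?subr0.
have ec b h g : e b * u h g = u h g * e b.
  by case: b; rewrite //= mulrBl mulrBr pc mul1r mulr1.
have e0 b h g : h != twist b g -> e b * u h g = 0.
  by case: b => /=; [exact: p1|exact: p0].
have [u1 us uM _ _] := uP.
exists (fun b h => e b * u h (twist b h)); split; last first.
  move=> h g; have -> : u h g = \sum_b e b * u h g.
    by rewrite big_bool /= -mulrDl subrK mul1r.
  apply: eq_bigr => b _; have [->|/e0->] := eqVneq h (twist b g); last first.
    by rewrite scale0r.
  by rewrite scale1r twistK.
split.
- by rewrite !twist1 u1 !mulr1 /= addrC subrK.
- move=> b d g h; rewrite mulr_mid -ec (mulrA (e b)) eM -mulrA.
  case: eqP => [<-|_]; last by rewrite mul0r.
  rewrite twistM uM mulr_sumr (bigD1 g) //= mulKg big1 ?addr0 // => z zg.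
  by rewrite mulrA e0 ?mul0r // twistK.
- by move=> b g; rewrite starM es us twistV -ec.
Qed.

End GradedProjection.

Section Coaction.
Variables (R : realType) (n : nat) (G : compact_quantum_group R).
Variable beta : galg 'S_n R[i]^o -> galg 'S_n G.
Implicit Types g h k x : 'S_n.
Definition coaction_matrix h g : G := beta (delta R[i] g) h.
Local Notation u := coaction_matrix.

Lemma natscale_inj (V : lmodType R[i]) (v : V) (a b : nat) :
  a != b -> v *+ a = v *+ b -> v = 0.
Proof.
wlog ab : a b / (a <= b)%N => [W|] nab E.
  by have [ab|/ltnW ba] := leqP a b; [exact: (W a b)|apply: (W b a) => //;
    rewrite eq_sym].
have : v *+ (b - a) = 0 by rewrite mulrnBr // E subrr.
move=> /eqP; rewrite -scaler_nat scaler_eq0 pnatr_eq0 subn_eq0 => /orP[ba|/eqP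
  //].
by rewrite eqn_leq ab ba in nab.
Qed.

Hypothesis betaP : is_isometric_coaction beta.

Let bhom : is_star_hom beta. Proof. by case: betaP => [[]]. Qed.

Lemma coaction_coef (x : galg 'S_n R[i]^o) k :
  beta x k = \sum_g x g *: u k g.
Proof.
have [bl _ _ _] := bhom.
rewrite (linear_delta x bl) sum_ffunE; apply: eq_bigr => g _.
by rewrite ffunE.
Qed.

(** Preservation of the trace, applied to the product of g^* and g'. *)
Lemma coaction_isometry g g' :
  \sum_h star (u h g) * u h g' = (g == g')%:R.
Proof.
have [bl b1 bM bs] := bhom; have [_ [btr _]] := betaP.
have := btr (star (delta R[i] g) * delta R[i] g').
rewrite bM bs galg_mulE (reindex_inj invg_inj) /=.
under eq_bigr => h _ do rewrite galg_starE invgK mulg1.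
rewrite /coaction_matrix => ->; rewrite delta_star -deltaM deltaE eq_sym
  -eq_mulVg1.
by case: eqP => _; rewrite ?scale1r ?scale0r.
Qed.

Lemma le_small_eq0 (a C : R) : 0 <= a -> 0 <= C ->
  (forall e, 0 < e -> a <= C * e) -> a = 0.
Proof.
move=> a0 C0 small; apply/le_anti; rewrite a0 andbT leNgt; apply/negP => ap.
have := small (a / (C + 1) / 2); rewrite !divr_gt0 // ?ltr_wpDl // => /(_ isT).
rewrite leNgt => /negP; apply; rewrite -mulrA -invfM mulrCA -[ltRHS]mulr1
  ltr_pM2l //.
rewrite ltr_pdivrMr ?mulr_gt0 // ?ltr_wpDl //; lra.
Qed.

(* [P = u u^*] fixes the span in the Podles condition, which is dense. *)
Lemma coaction_coisometry h k : \sum_g u h g * star (u k g) = (h == k)%:R.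
Proof.
have [[_ _ pod] _] := betaP.
pose P l := \sum_g u h g * star (u l g); rewrite -/(P k).
have Pfix y : lin_span (fun w => exists v a, w = beta v * elem_tens 1 a) y ->
    \sum_l P l * y l = y h.
  case=> m [c [w [wP ->]]].
  have wfix i : \sum_l P l * w i l = w i h.
    have [x [a ->]] := wP i.
    have val_w l : (beta x * elem_tens 1 a) l = beta x l * a.
      rewrite galg_mulE (bigD1 l) //= big1 => [|z zl].
        by rewrite mulVg !ffunE eqxx scale1r addr0.
      by rewrite !ffunE -eq_mulVg1 (negbTE zl) scale0r mulr0.
    under eq_bigr => l _ do rewrite val_w mulrA.
    rewrite -mulr_suml val_w; congr (_ * a).
    rewrite !coaction_coef.
    under eq_bigr => l _ do rewrite coaction_coef mulr_sumr.
    rewrite exchange_big; apply: eq_bigr => g _ /=.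
    under eq_bigr => l _ do rewrite -scalerAr mulr_suml.
    rewrite -scaler_sumr exchange_big /=; congr (_ *: _).
    under eq_bigr => g' _ do (under eq_bigr => l _ do rewrite -mulrA);
    rewrite /=; under eq_bigr => g' _ do rewrite -mulr_sumr coaction_isometry.
    rewrite (bigD1 g) //= eqxx mulr1 big1 ?addr0 // => g' gg'.
    by rewrite (negbTE gg') mulr0.
  under eq_bigr => l _ do rewrite sum_ffunE mulr_sumr.
  rewrite exchange_big sum_ffunE; apply: eq_bigr => i _ /=.
  by rewrite ffunE -wfix scaler_sumr; apply: eq_bigr => l _;
    rewrite ffunE scalerAr.
apply/eqP; rewrite -subr_eq0; apply/eqP/cnorm_eq0.
(* This factor bounds row [h] of [P] minus the identity. It is applied to the difference between the
   basis vector at [k] and its approximation in the span, where [P] acts as the identity. *)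
apply: (@le_small_eq0 _ (\sum_l cnorm (P l) + 1)); first exact: cnorm_ge0.
  by rewrite addr_ge0 // sumr_ge0 // => l _; exact: cnorm_ge0.
move=> e e0; pose z : galg 'S_n G := [ffun l => (l == k)%:R].
have [y /Pfix yP zy] := pod z e e0.
have -> : P k - (h == k)%:R = \sum_l P l * (z l - y l) - (z h - y h).
  under eq_bigr => l _ do rewrite mulrBr.
  rewrite sumrB yP (bigD1 k) //= big1 => [|l lk].
    by rewrite !ffunE eqxx mulr1 addr0 opprB addrA subrK.
  by rewrite ffunE (negbTE lk) mulr0.
apply: le_trans (cnormD _ _) _; rewrite cnormN mulrDl mul1r mulr_suml.
apply: lerD; last exact/ltW/zy.
apply: le_trans (cnorm_sum _) _; apply: ler_sum => l _.
by apply: le_trans (cnormM _ _) _; rewrite ler_wpM2l ?cnorm_ge0 // ltW.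
Qed.

Lemma coaction_graded_matrix : graded_matrix u.
Proof.
have [bl b1 bM bs] := bhom; have [_ [_ bD]] := betaP.
have direct h g g' : u h (g * g')%g = \sum_x u x g * u (x^-1 * h)%g g'.
  by rewrite /coaction_matrix deltaM bM galg_mulE.
split=> //.
- by rewrite /coaction_matrix delta1 b1 ffunE eqxx.
- move=> h g; rewrite /coaction_matrix -delta_star bs galg_starE.
  by rewrite invgK.
- move=> h h' g.
  (* [M] is the defect, as a row vector. Multiplicativity and the relation u u^* = 1 give M u^* = 0;
     multiplying by [u] and using u^* u = 1 gives [M = 0]. *)
  pose M g := \sum_x u h x * u h' (x^-1 * g)%g - u (h * h')%g g.
  have Mk k : \sum_g' M g' * star (u k g') = 0.
    under eq_bigr => g' _ do rewrite mulrBl mulr_suml.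
    rewrite sumrB coaction_coisometry exchange_big /=.
    under eq_bigr => x _ do rewrite (reindex_inj (mulgI x)) /=.
    under eq_bigr => x _ do under eq_bigr => y _ do
      rewrite mulKg direct star_sum mulr_sumr.
    under eq_bigr => x _ do rewrite exchange_big /=.
    rewrite exchange_big /=.
    under eq_bigr => a _ do under eq_bigr => x _ do under eq_bigr => y _ do
      rewrite starM mulr_mid.
    under eq_bigr => a _ do under eq_bigr => x _ do
      rewrite -mulr_suml -mulr_sumr coaction_coisometry.
    rewrite (bigD1 h) //= [X in _ + X - _]big1 => [|a ah].
      have [E|E] := eqVneq h' (h^-1 * k)%g.
        under eq_bigr => x _ do rewrite mulr1.
        by rewrite coaction_coisometry eqxx addr0 E mulKVg eqxx subrr.
      rewrite big1 => [|x _]; last by rewrite mulr0 mul0r.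
      rewrite addr0 (_ : (h * h' == k)%g = false) ?subrr //.
      by apply: contra_neqF E => /eqP <-; rewrite mulKg.
    case: (_ == _); last by rewrite big1 // => x _; rewrite mulr0 mul0r.
    under eq_bigr => x _ do rewrite mulr1.
    by rewrite coaction_coisometry eq_sym (negbTE ah).
  apply/eqP; rewrite eq_sym -subr_eq0; apply/eqP; rewrite -/(M g).
  have : \sum_k (\sum_g' M g' * star (u k g')) * u k g = 0.
    by rewrite big1 // => k _; rewrite Mk mul0r.
  under eq_bigr => k _ do rewrite mulr_suml.
  rewrite exchange_big /=.
  under eq_bigr => g' _ do (under eq_bigr => k _ do rewrite -mulrA);
  rewrite /=; under eq_bigr => g' _ do rewrite -mulr_sumr coaction_isometry.
  rewrite (bigD1 g) //= eqxx mulr1 big1 ?addr0 // => g' gg'.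
  by rewrite (negbTE gg') mulr0.
- move=> h g lhg; have := congr1 (fun f : galg 'S_n G => f h) (bD (delta R[i]
  g)).
  have -> : Dhat (delta R[i] g) = (ell g)%:R *: delta R[i] g.
    apply/ffunP => x; rewrite !ffunE; case: eqP => [->|_]; last first.
      by rewrite mul0rn [RHS]mulr0.
    by rewrite [RHS]mulr1.
  rewrite (linear_scale bl) !ffunE scaler_nat => E.
  by apply: (natscale_inj _ E); rewrite eq_sym.
Qed.

End Coaction.

(** * The universal coaction *)

Section DoubleCoaction.
Variables (R : realType) (n : nat).
Implicit Types g h z : 'S_n.
Local Notation CSn := (galg 'S_n R[i]^o).
Local Notation delta := (@delta R[i] 'S_n).

Section Coefficients.
Variables (A : starAlgType R[i]) (w : bool -> 'S_n -> A).

(** On [delta g] this is g (x) w false g + theta g (x) w true (theta g). The family [w] is kept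
    general because every isometric coaction turns out to have this form. *)
Definition double_coaction (x : CSn) : galg 'S_n A :=
  [ffun h => \sum_b x (twist b h) *: w b h].

Lemma double_coactionE x h :
  double_coaction x h = \sum_b x (twist b h) *: w b h.
Proof. by rewrite ffunE. Qed.

Lemma double_coaction_delta g h :
  double_coaction (delta g) h = \sum_b (h == twist b g)%:R *: w b h.
Proof.
rewrite double_coactionE; apply: eq_bigr => b _.
by rewrite deltaE (can2_eq (@twistK _ b) (@twistK _ b)).
Qed.

Lemma double_coaction_linear : linear double_coaction.
Proof.
move=> c x y; apply/ffunP => h; rewrite !ffunE scaler_sumr -big_split /=.
by apply: eq_bigr => b _; rewrite !ffunE scalerDl scalerA.
Qed.

Hypothesis wP : double_rep w.

Lemma double_coaction_hom : is_star_hom double_coaction.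
Proof.
have [w1 wM ws] := wP; split; first exact: double_coaction_linear.
- apply/ffunP => h; rewrite double_coactionE big_bool /= -!delta1 !deltaE.
  have -> : (theta h == 1%g) = (h == 1%g).
    by rewrite (can2_eq (@thetaK n) (@thetaK n)) -[theta 1%g]/(twist true 1%g)
      twist1.
  rewrite [RHS]ffunE -scalerDr addrC; case: eqP => [->|_].
    by rewrite w1 scale1r.
  by rewrite scale0r.
- move=> x y; apply/ffunP => h; rewrite double_coactionE galg_mulE.
  transitivity (\sum_z \sum_b (x (twist b z) * y (twist b (z^-1 * h)%g)) *: w b
    h).
    rewrite exchange_big; apply: eq_bigr => b _.
    rewrite galg_mulE scaler_suml (reindex_inj (inv_inj (@twistK n b))) /=.
    by apply: eq_bigr => z _; rewrite -twistV -twistM.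
  apply: eq_bigr => z _; rewrite !double_coactionE !big_bool /=.
  rewrite mulrDl !mulrDr -!scalerAl -!scalerAr !wM /= !mulKVg !scaler0 addr0
    add0r.
  by rewrite !scalerA.
- move=> x; apply/ffunP => h; rewrite galg_starE !double_coactionE star_sum.
  apply: eq_bigr => b _; rewrite galg_conjE starZ ws invgK.
  by rewrite twistV.
Qed.

End Coefficients.

Local Notation K := (double_cqg R (@thetaM n) (@thetaK n)).
Local Notation copy := (@copy R 'S_n).
Local Notation Kalg := (galg ('S_n * 'Z_2)%type R[i]^o).
Local Notation t := (@galg_tens R ('S_n * 'Z_2)%type ('S_n * 'Z_2)%type
  (('S_n * 'Z_2) * ('S_n * 'Z_2))%type id).
Local Notation alpha := (double_coaction copy : CSn -> galg 'S_n Kalg).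

Lemma cqg_is_tensor (G : compact_quantum_group R) : is_cstar_tensor (@cqg_tens
  R G).
Proof. by case: (cqg_tensP G). Qed.

Lemma sum_delta_twist b h (W : lmodType R[i]) (v : 'S_n -> W) :
  \sum_g (h == twist b g)%:R *: v g = v (twist b h) :> W.
Proof.
rewrite (bigD1 (twist b h)) //= twistK eqxx scale1r big1 ?addr0 // => g gh.
rewrite eq_sym (can2_eq (@twistK n b) (@twistK n b)) (negbTE gh);
  exact: scale0r.
Qed.

Lemma alpha_comul x :
  tens_id t alpha (alpha x) = id_tens (@double_comul R _ (@theta n)) (alpha x).
Proof.
have tl b := tensor_linl (double_tensP R 'S_n) b.
have tr a := tensor_linr (double_tensP R 'S_n) a.
have [Dl _ _ _] := @double_comul_hom R _ _ (@thetaM n).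
apply/ffunP => h; rewrite !ffunE.
under eq_bigr => g _ do rewrite double_coaction_delta (linear_sumr (tl _)).
rewrite exchange_big /=.
under eq_bigr => c _ do under eq_bigr => g _ do rewrite (linear_scale (tl _)).
under eq_bigr => c _ do rewrite (sum_delta_twist _ _ (fun g => t (copy c h)
  (alpha x g))).
under eq_bigr => c _ do rewrite double_coactionE (linear_sumr (tr _)).
under eq_bigr => c _ do under eq_bigr => b _ do rewrite (linear_scale (tr _)).
rewrite (linear_sumr Dl).
under [RHS]eq_bigr => b _ do
  rewrite (linear_scale Dl) double_comul_copy /comul_copy.
have perm4 (V : nmodType) (y1 y2 y3 y4 : V) :
    y1 + y2 + (y3 + y4) = y3 + y2 + (y4 + y1).
  by rewrite [y1 + y2]addrC addrC addrACA.
rewrite [LHS]big_bool [X in X + _ = _]big_bool [X in _ + X = _]big_bool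
  [RHS]big_bool.
rewrite /twist thetaK (scalerDr (x (theta h))) (scalerDr (x h)).
exact: perm4.
Qed.

(** A right factor in the copy [b] reduces [alpha (delta (twist b k))] to k (x) copy b k, and then
    k^-1 y turns [copy b k] into [copy b y]. So the span is already everything. *)
Lemma alpha_span (z : galg 'S_n Kalg) :
  lin_span (fun w => exists x a, w = alpha x * elem_tens 1 a) z.
Proof.
pose v (j : 'S_n * (('S_n * 'Z_2) * bool)) : galg 'S_n Kalg :=
  alpha (delta (twist j.2.2 j.1)) * elem_tens 1 (copy j.2.2 (j.1^-1 *
    j.2.1.1)%g).
pose a (j : 'S_n * (('S_n * 'Z_2) * bool)) : R[i] :=
  (z j.1 : galg _ _) j.2.1 * sgn R j.2.2 j.2.1.2.
have eE (y : Kalg) g : (elem_tens 1 y : galg 'S_n Kalg) g = (g == 1%g)%:R *: y.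
  by rewrite ffunE -delta1 deltaE.
have vE k p b h : v (k, (p, b)) h = (h == k)%:R *: copy b p.1.
  rewrite /v /= galg_mulE (bigD1 h) //= big1 => [|y yh]; last first.
    by rewrite eE -eq_mulVg1 (negbTE yh) scale0r mulr0.
  rewrite mulVg eE eqxx scale1r addr0.
  rewrite double_coaction_delta mulr_suml (bigD1 b) //= big1 => [|c cb].
    rewrite -scalerAl copyM eqxx twistK addr0.
    by case: eqP => [->|_]; [rewrite mulKVg|rewrite !scale0r].
  by rewrite -scalerAl copyM (negbTE cb) scaler0.
have -> : z = \sum_j a j *: v j.
  apply/ffunP => h; rewrite sum_ffunE -(pair_bigA _ (fun k q => (a (k, q) *: v
    (k, q)) h)) /=.
  rewrite (bigD1 h) //= [X in _ + X]big1 => [|k kh]; last first.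
    apply: big1 => -[p b] _; rewrite ffunE vE eq_sym (negbTE kh) scale0r.
    exact: scaler0.
  rewrite addr0 -(pair_bigA _ (fun p b => (a (h, (p, b)) *: v (h, (p, b))) h))
    /=.
  rewrite {1}(delta_sum (z h)); apply: eq_bigr => p _.
  rewrite delta_copy_sum scaler_sumr; apply: eq_bigr => b _.
  by rewrite ffunE vE eqxx scale1r scalerA.
apply: lin_span_sum => j.
by exists (delta (twist j.2.2 j.1)), (copy j.2.2 (j.1^-1 * j.2.1.1)%g).
Qed.

Lemma alpha_podles : podles (G := K) alpha.
Proof.
move=> z e e0; exists z; first exact: alpha_span.
by move=> g; rewrite subrr cnorm0.
Qed.

Lemma alpha_trace x : alpha x 1%g = x 1%g *: 1.
Proof.
rewrite double_coactionE; under eq_bigr => b _ do rewrite twist1.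
by rewrite big_bool /= -scalerDr addrC copy1.
Qed.

Lemma alpha_Dhat x : alpha (Dhat x) = Dhat (alpha x).
Proof.
apply/ffunP => h; rewrite [RHS]ffunE !double_coactionE -sumrMnl.
apply: eq_bigr => b _; rewrite ffunE -scalerMnl.
by case: b; rewrite //= ell_theta.
Qed.

Lemma alpha_isometric : is_isometric (G := K) alpha.
Proof. by split; [exact: alpha_trace|exact: alpha_Dhat]. Qed.

Lemma alpha_isometric_coaction : is_isometric_coaction (G := K) alpha.
Proof.
split; last exact: alpha_isometric.
split; [exact: double_coaction_hom (copy_double_rep R 'S_n)|exact:
  alpha_comul|].
exact: alpha_podles.
Qed.

End DoubleCoaction.

Section Universality.
Variables (R : realType) (n : nat).
Hypothesis n_gt2 : (2 < n)%N.
Implicit Types g h : 'S_n.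
Local Notation CSn := (galg 'S_n R[i]^o).
Local Notation delta := (@delta R[i] 'S_n).
Local Notation K := (double_cqg R (@thetaM n) (@thetaK n)).
Local Notation copy := (@copy R 'S_n).
Local Notation Kalg := (galg ('S_n * 'Z_2)%type R[i]^o).
Local Notation t := (@galg_tens R ('S_n * 'Z_2)%type ('S_n * 'Z_2)%type
  (('S_n * 'Z_2) * ('S_n * 'Z_2))%type id).
Local Notation alpha := (double_coaction copy : CSn -> galg 'S_n Kalg).
Local Notation comul := (@double_comul R 'S_n (@theta n)).

Lemma theta_moves_sgen : exists i : 'I_n.-1, theta (sgen i) != sgen i.
Proof.
have n1 : (0 < n.-1)%N by case: (n) n_gt2 => [|[]].
exists (Ordinal n1); rewrite theta_sgen (inj_eq (@sgen_inj n)) -val_eqE /=.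
by case: (n) n_gt2 => [|[|[]]].
Qed.

Lemma alpha_copy b g : copy b 1%g * alpha (delta (twist b g)) g = copy b g.
Proof.
rewrite double_coaction_delta mulr_sumr (bigD1 b) //= big1 => [|c cb].
  by rewrite -scalerAr copyM eqxx mul1g twistK eqxx scale1r addr0.
by rewrite -scalerAr copyM [b == c]eq_sym (negbTE cb) scaler0.
Qed.

(* At a generator [s] with [theta s <> s] the coefficients of [alpha] separate
   the two copies, so they generate both units. *)
Lemma double_hom_ext (B : starAlgType R[i]) (f f' : Kalg -> B) :
  is_star_hom f -> is_star_hom f' ->
  (forall x h, f (alpha x h) = f' (alpha x h)) -> f =1 f'.
Proof.
move=> [fl f1 fM fs] [fl' f1' fM' fs'] ff'.
have [i ti] := theta_moves_sgen; set s := sgen i in ti.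
have copy_s b : alpha (delta (twist b s)) s = copy b s.
  rewrite double_coaction_delta (bigD1 b) //= twistK eqxx scale1r big1 ?addr0
    // => c cb.
  have -> : (s == twist c (twist b s)) = false; last exact: scale0r.
  by case: c b cb => [] [] //= _; rewrite eq_sym (negbTE ti).
have copy1 b : copy b 1%g = copy b s * copy b s by rewrite copyM eqxx sgenK.
apply: double_ext => // b g.
by rewrite -alpha_copy fM fM' copy1 fM fM' -copy_s !ff'.
Qed.

Lemma double_lift_coaction (A : starAlgType R[i]) (w : bool -> 'S_n -> A) x :
  double_coaction w x = id_tens (double_lift w) (alpha x).
Proof.
apply/ffunP => h; rewrite [RHS]ffunE !double_coactionE.
have l := galg_lift_linear
  (fun p : 'S_n * 'Z_2 => w false p.1 + (-1) ^+ (p.2 : nat) *: w true p.1).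
rewrite /double_lift (linear_sumr l); apply: eq_bigr => b _.
by rewrite (linear_scale l); congr (_ *: _); rewrite -(double_lift_copy w b h).
Qed.

Lemma alpha_universal (G : compact_quantum_group R) (beta : CSn -> galg 'S_n G)
  :
  is_isometric_coaction beta ->
  exists! Phi : K -> G,
    cqg_compatible (K := K) Phi /\ forall x, beta x = id_tens Phi (alpha x).
Proof.
move=> betaP; have [w [wP uw]] := graded_double_rep n_gt2
  (coaction_graded_matrix betaP).
have betaE x : beta x = double_coaction w x.
  apply/ffunP => h; rewrite (coaction_coef betaP) double_coactionE.
  under eq_bigr => g _ do rewrite (uw h g) scaler_sumr.
  rewrite exchange_big; apply: eq_bigr => b _ /=.
  under eq_bigr => g _ do rewrite scalerA mulrC -scalerA.
  exact: (sum_delta_twist b h (fun g => x g *: w b h)).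
pose Phi : Kalg -> G := double_lift w.
have PhiP : is_star_hom Phi := double_lift_hom wP.
have betaPhi x : beta x = id_tens Phi (alpha x) by rewrite betaE
  double_lift_coaction.
have betaPhiE x h : beta x h = Phi (alpha x h) by rewrite betaPhi ffunE.
exists Phi; split; last first.
  move=> Phi' [[Phi'P _] beta']; apply: funext; apply: double_hom_ext => // x h.
  by rewrite -betaPhiE beta' ffunE.
split=> //; split=> //.
have tP := cqg_is_tensor G.
have Phi2P := galg_tens_homP (@idK _) (@idK _) (@idM _) tP PhiP PhiP.
exists (galg_tens_hom id cqg_tens Phi Phi); split; first exact: Phi2P.
have [Phi2h Phi2t] := Phi2P; have [Phi2l _ _ _] := Phi2h.
(* Compatibility with the comultiplications is an equality of *-homomorphisms, so it can be checked
   on the coefficients of [alpha]. There it follows from the coaction identities of [alpha] and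
   [beta]. *)
have := @double_hom_ext _ (galg_tens_hom id cqg_tens Phi Phi \o comul)
  (@cqg_comul R G \o Phi).
apply.
- exact: is_star_hom_comp (double_comul_hom R (@thetaM n)) Phi2h.
- exact: is_star_hom_comp PhiP (cqg_comul_hom G).
move=> x h /=.
have [[_ bco _] _] := betaP.
rewrite -betaPhiE.
have bE : \sum_g cqg_tens (beta (delta g) h) (beta x g) = cqg_comul (beta x h).
  by have := congr1 (fun f : galg 'S_n _ => f h) (bco x);
    rewrite ffunE [RHS]ffunE.
have aE : \sum_g t (alpha (delta g) h) (alpha x g) = comul (alpha x h).
  have := congr1 (fun f : galg 'S_n _ => f h) (alpha_comul x).
  by rewrite ffunE [RHS]ffunE.
rewrite -bE -aE.
rewrite (linear_sumr Phi2l); apply: eq_bigr => g _.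
by rewrite Phi2t -!betaPhiE.
Qed.

Lemma alpha_quantum_isometry_group : is_quantum_isometry_group (K := K) alpha.
Proof. by split; [exact: alpha_isometric_coaction|exact: alpha_universal]. Qed.

End Universality.

(** * The doubling of the group algebra *)

Section DoublingMaps.
Variables (C : numClosedFieldType) (n : nat).
Local Notation I := ('S_n * bool)%type.
Local Notation e := (basis_vec C^o).
Local Notation D := (hopf_dual (group_hopf C 'S_n)).
Local Notation thetaC := (fun x : {ffun 'S_n -> C^o} =>
  \sum_(g : 'S_n) x g *: basis_vec C^o (theta g)).
Local Notation B := (crossed_product D (theta_dual thetaC)).
Local Notation H := (doubling (group_hopf C 'S_n) thetaC).
Implicit Types (g h x y : 'S_n) (a b c : bool) (f : {ffun 'S_n -> C^o}).

Lemma basis_vecE (J : finType) (j k : J) : e j k = (k == j)%:R.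
Proof. by rewrite ffunE. Qed.

Lemma pairing_basis (J : finType) (f : {ffun J -> C^o}) j : pairing f (e j) = f
  j.
Proof.
rewrite /pairing (bigD1 j) //= big1 => [|k kj].
  by rewrite basis_vecE eqxx mulr1 addr0.
by rewrite basis_vecE (negbTE kj) mulr0.
Qed.

Lemma sum_basis (J : finType) (V : lmodType C) (j : J) (F : J -> V) :
  \sum_k e j k *: F k = F j.
Proof.
rewrite (bigD1 j) //= big1 ?addr0 => [|k kj].
  by rewrite basis_vecE eqxx scale1r.
by rewrite basis_vecE (negbTE kj) scale0r.
Qed.

Lemma dual_mulE f f' g : hmul D f f' g = f g * f' g.
Proof. by rewrite ffunE /= sum_basis pairing_basis ffunE. Qed.

Lemma dual_comulE f g h : hcomul D f (g, h) = f (g * h)%g.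
Proof.
rewrite ffunE /= -[RHS]pairing_basis; congr (pairing _ _).
exact: (esym (deltaM C g h)).
Qed.

Lemma dual_counitE f : hcounit D f = f 1%g.
Proof. exact: (pairing_basis f 1%g). Qed.

Lemma dual_antipodeE f g : hantipode D f g = f g^-1%g.
Proof. by rewrite ffunE /= sum_basis pairing_basis. Qed.

Lemma dual_starE f g : hstar D f g = (f g)^*.
Proof.
rewrite ffunE /= sum_basis; congr (_^*).
rewrite -[RHS]pairing_basis; congr (pairing _ _).
by rewrite -[g in RHS]invgK; exact: (delta_star C g^-1%g).
Qed.

Lemma dual_thetaE f g : theta_dual thetaC f g = f (theta g).
Proof. by rewrite ffunE sum_basis pairing_basis. Qed.

Lemma crossed_part_elt b f f' :
  crossed_part b (crossed_elt f f') = if b then f' else f.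
Proof. by apply/ffunP => g; rewrite !ffunE; case: b. Qed.

Lemma crossed_eltE f f' g b : crossed_elt f f' (g, b) = if b then f' g else f g.
Proof. by rewrite ffunE. Qed.

Lemma crossed_partE b (v : {ffun I -> C^o}) g : crossed_part b v g = v (g, b).
Proof. by rewrite ffunE. Qed.

(** Since [U] is group-like, the dual product does not mix the two copies; on each of them it is the
    convolution of the group. *)
Lemma doubling_mulE u v g b :
  hmul H u v (g, b) = \sum_x u (x, b) * v ((x^-1 * g)%g, b).
Proof.
rewrite ffunE /pairing.
transitivity (\sum_(p : I * I)
   (u p.1 * v p.2) * ((p.1.1 * p.2.1 == g)%g && ((p.1.2 == b) && (p.2.2 ==
     b)))%:R).
  apply: eq_bigr => -[[x a] [y c]] _; rewrite [tensv _ _ _]ffunE /=;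
    congr (_ * _).
  rewrite ffunE /=; case: eqVneq => [<-|ac].
    by rewrite dual_comulE crossed_partE basis_vecE xpair_eqE andbb.
  have -> : (a == b) && (c == b) = false by case: a b c ac => [] [] [].
  by rewrite andbF.
rewrite -(pair_bigA _ (fun p q : I => (u p * v q) *
  ((p.1 * q.1 == g)%g && ((p.2 == b) && (q.2 == b)))%:R)) /=.
transitivity (\sum_x \sum_a \sum_(q : I) (u (x, a) * v q) *
    ((x * q.1 == g)%g && ((a == b) && (q.2 == b)))%:R).
  by rewrite [RHS]pair_bigA; apply: eq_bigr => -[].
apply: eq_bigr => x _; rewrite (bigD1 b) //= [X in _ + X]big1 => [|a ab];
  last first.
  by apply: big1 => q _; rewrite (negbTE ab) andbF mulr0.
rewrite addr0 (bigD1 ((x^-1 * g)%g, b)) //= mulKVg !eqxx mulr1 big1 ?addr0 //.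
move=> [y c] /= ne.
have -> : (x * y == g)%g = (y == x^-1 * g)%g.
  by rewrite -[RHS](inj_eq (mulgI x)) mulKVg.
by rewrite ?eqxx -xpair_eqE (negbTE ne) mulr0.
Qed.

Lemma crossed_counitE v :
  hcounit B v = hcounit D (crossed_part false v) + hcounit D (crossed_part true
    v).
Proof. by []. Qed.

Lemma crossed_antipodeE v : hantipode B v = crossed_elt
  (hantipode D (crossed_part false v))
  (theta_dual thetaC (hantipode D (crossed_part true v))).
Proof. by []. Qed.

Lemma crossed_starE v : hstar B v = crossed_elt
  (hstar D (crossed_part false v))
  (theta_dual thetaC (hstar D (crossed_part true v))).
Proof. by []. Qed.

Lemma crossed_mulE v v' : hmul B v v' = crossed_elt
  (hmul D (crossed_part false v) (crossed_part false v') +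
   hmul D (crossed_part true v) (theta_dual thetaC (crossed_part true v')))
  (hmul D (crossed_part false v) (crossed_part true v') +
   hmul D (crossed_part true v) (theta_dual thetaC (crossed_part false v'))).
Proof. by []. Qed.

Lemma doubling_oneE g b : hone H (g, b) = (g == 1%g)%:R.
Proof.
rewrite ffunE crossed_counitE !dual_counitE !crossed_partE !basis_vecE.
rewrite !xpair_eqE eq_sym.
by case: b; rewrite ?andbT ?andbF ?addr0 ?add0r.
Qed.

Lemma doubling_starE u g b : hstar H u (g, b) = (u (g^-1%g, b))^*.
Proof.
rewrite ffunE -[u _]pairing_basis; congr ((pairing _ _)^*).
apply/ffunP => -[h c].
rewrite crossed_starE crossed_antipodeE !crossed_part_elt crossed_eltE.
rewrite basis_vecE xpair_eqE.
case: c.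
  rewrite dual_thetaE dual_starE dual_thetaE thetaK dual_antipodeE
    crossed_partE.
  by rewrite basis_vecE xpair_eqE rmorph_nat (inv_eq invgK).
rewrite dual_starE dual_antipodeE crossed_partE.
by rewrite basis_vecE xpair_eqE rmorph_nat (inv_eq invgK).
Qed.

(** The basis functions e_x are orthogonal idempotents, and U^a e_y = e_(theta^a y) U^a. This is the
    source of [theta] in the comultiplication of the doubling. *)
Lemma crossed_mul_basis x y a c :
  hmul B (e (x, a)) (e (y, c)) = (x == twist a y)%:R *: e (x, a (+) c).
Proof.
apply/ffunP => -[h d]; rewrite crossed_mulE crossed_eltE.
have vE (b : bool) z k : crossed_part b (e (z, k)) h = ((h == z) && (b ==
  k))%:R.
  by rewrite crossed_partE basis_vecE.
have tE (b : bool) z k : theta_dual thetaC (crossed_part b (e (z, k))) h =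
    ((h == theta z) && (b == k))%:R.
  rewrite dual_thetaE crossed_partE basis_vecE xpair_eqE.
  by rewrite (can2_eq (@thetaK n) (@thetaK n)).
have sE : ((x == twist a y)%:R *: e (x, a (+) c)) (h, d) =
    (x == twist a y)%:R * ((h == x) && (d == a (+) c))%:R :> C.
  by rewrite ffunE basis_vecE.
rewrite sE {sE}; case: d;
  rewrite [(_ + _ : {ffun _}) h]ffunE !dual_mulE !vE !tE -!natrM !mulnb;
  case: a c => [] [] /=;
  rewrite ?andbT ?andbF ?addr0 ?add0r //;
  by case: (h =P x) => [->|]; rewrite ?andbT ?andbF.
Qed.

Lemma doubling_comulE u x y a c :
  hcomul H u ((x, a), (y, c)) = (x == twist a y)%:R * u (x, a (+) c).
Proof.
rewrite ffunE crossed_mul_basis -[u _]pairing_basis /pairing mulr_sumr.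
by apply: eq_bigr => p _; rewrite ffunE [LHS]mulrCA.
Qed.

End DoublingMaps.

(** * Isomorphism with the doubling *)

Lemma cqg_compatible_id (R : realType) (G : compact_quantum_group R) :
  cqg_compatible (@id G).
Proof. by split=> //; exists id. Qed.

Lemma cqg_compatible_comp (R : realType) (G1 G2 G3 : compact_quantum_group R)
    (f : G1 -> G2) (g : G2 -> G3) :
  cqg_compatible f -> cqg_compatible g -> cqg_compatible (g \o f).
Proof.
case=> fP [f2 [[f2P f2t] f2D]] [gP [g2 [[g2P g2t] g2D]]].
split; first exact: is_star_hom_comp fP gP.
exists (g2 \o f2); split; last by move=> a /=; rewrite f2D g2D.
split; first exact: is_star_hom_comp f2P g2P.
by move=> a b /=; rewrite f2t g2t.
Qed.

Section DoubleBasis.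
Variables (R : realType) (S : finGroupType).
Local Notation I := (S * bool)%type.
Local Notation V := {ffun I -> R[i]^o}.
Implicit Types (g x y : S) (u v : V).

Section Span.
Variables (A : starAlgType R[i]) (w : bool -> S -> A).

Definition double_span (u : V) : A := \sum_p u p *: w p.2 p.1.

Lemma double_span_linear : linear double_span.
Proof.
move=> c u v; rewrite /double_span scaler_sumr -big_split /=.
by apply: eq_bigr => p _; rewrite !ffunE scalerDl scalerA.
Qed.

Lemma double_spanE u : double_span u = \sum_b \sum_g u (g, b) *: w b g.
Proof. by rewrite exchange_big pair_bigA; apply: eq_bigr => -[]. Qed.

Lemma double_span_basis p : double_span (basis_vec R[i]^o p) = w p.2 p.1.
Proof. exact: (sum_basis p (fun q => w q.2 q.1)). Qed.

Hypothesis wP : double_rep w.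

Lemma double_span1 u :
  (forall g b, u (g, b) = (g == 1%g)%:R) -> double_span u = 1.
Proof.
case: wP => w1 _ _ u1; rewrite double_spanE -w1 big_bool addrC /=.
congr (_ + _); rewrite (bigD1 1%g) //= u1 eqxx scale1r big1 ?addr0 // => g g1;
  by rewrite u1 (negbTE g1) scale0r.
Qed.

Lemma double_spanM u v (uv : V) :
  (forall g b, uv (g, b) = \sum_x u (x, b) * v ((x^-1 * g)%g, b)) ->
  double_span uv = double_span u * double_span v.
Proof.
case: wP => _ wM _ uvE.
have summand b : (\sum_x u (x, b) *: w b x) * (\sum_y v (y, b) *: w b y) =
    \sum_g uv (g, b) *: w b g.
  rewrite big_distrlr /=.
  under eq_bigr => x _ do rewrite (reindex_inj (mulgI x^-1)%g) /=.
  rewrite exchange_big; apply: eq_bigr => g _ /=.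
  rewrite uvE scaler_suml; apply: eq_bigr => x _.
  by rewrite -scalerAl -scalerAr scalerA wM eqxx mulKVg.
have cross b c : b != c ->
    (\sum_x u (x, b) *: w b x) * (\sum_y v (y, c) *: w c y) = 0.
  move=> bc; rewrite big_distrlr big1 // => x _; rewrite big1 // => y _ /=.
  by rewrite -scalerAl -scalerAr wM (negbTE bc) !scaler0.
rewrite !double_spanE !big_bool /= mulrDl !mulrDr !summand.
by rewrite (cross true false) // (cross false true) // addr0 add0r.
Qed.

Lemma double_span_star u v :
  (forall g b, v (g, b) = (u (g^-1%g, b))^*) -> double_span v = star
    (double_span u).
Proof.
case: wP => _ _ ws vE; rewrite !double_spanE star_sum; apply: eq_bigr => b _.
rewrite star_sum (reindex_inj invg_inj); apply: eq_bigr => g _ /=.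
by rewrite vE invgK starZ ws.
Qed.

End Span.

Lemma double_span_copy_bij : bijective (double_span (@copy R S)).
Proof.
(* The Fourier transform in the variable of Z_2; the normalising factor 1/2 is part of [copy]. *)
pose E (a : galg (S * 'Z_2)%type R[i]^o) : V :=
  [ffun p => a (p.1, 0) + (-1) ^+ (p.2 : bool) * a (p.1, 1)].
have El : linear E.
  move=> c x y; apply/ffunP => p; rewrite !ffunE mulrDr addrACA scalerDr.
  by rewrite -scalerAr.
have Ecopy b g : E (copy R b g) = basis_vec R[i]^o (g, b).
  apply/ffunP => -[h c]; rewrite copy.unlock !ffunE /= !xpair_eqE /=.
  have -> : ((0 : 'Z_2) == 1) = false by [].
  have -> : ((1 : 'Z_2) == 0) = false by [].
  rewrite !eqxx !andbT !andbF.
  case: (h == g); case: b c => [] [] /=;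
    rewrite ?expr0 ?expr1 /GRing.scale /= ?mulr0 ?mulr1 ?addr0 ?add0r ?mulN1r
      ?mul1r ?mulrN ?opprK ?subrr //.
  1,2: by rewrite !mulr1 -[2^-1]mul1r; exact: esym (splitr 1).
  1,2: by rewrite !mulr0 addr0.
have Fl := double_span_linear (@copy R S).
exists E => [u|a].
  rewrite (linear_sumr El) [RHS](_ : u = \sum_p u p *: basis_vec R[i]^o p).
    by apply: eq_bigr => -[g b] _; rewrite (linear_scale El) Ecopy.
  apply/ffunP => q; rewrite sum_ffunE (bigD1 q) //= big1 => [|p pq].
    by rewrite !ffunE eqxx addr0 [RHS]mulr1.
  by rewrite !ffunE eq_sym (negbTE pq); exact: scaler0.
apply: (double_ext (f := fun a => double_span (@copy R S) (E a)) (f' := id)) =>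
  //.
  by move=> c x y; rewrite El Fl.
by move=> b g; rewrite Ecopy double_span_basis.
Qed.

End DoubleBasis.

Section MainTheorem.
Variables (R : realType) (n : nat).
Hypothesis n_gt2 : (2 < n)%N.
Local Notation CSn := (galg 'S_n R[i]^o).
Local Notation Kalg := (galg ('S_n * 'Z_2)%type R[i]^o).
Local Notation K := (double_cqg R (@thetaM n) (@thetaK n)).
Local Notation copy := (@copy R 'S_n).
Local Notation alpha := (double_coaction copy : CSn -> galg 'S_n Kalg).

Definition double_comul_rel (G : compact_quantum_group R) (w : bool -> 'S_n ->
  G) :=
  forall b g, cqg_comul (w b g) =
    cqg_tens (w false g) (w b g) + cqg_tens (w true g) (w (~~ b) (theta g)).

Lemma quantum_isometry_group_iso (G : compact_quantum_group R)
    (beta : CSn -> galg 'S_n G) : is_quantum_isometry_group beta ->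
  exists Phi : Kalg -> G, [/\ is_star_hom Phi, bijective Phi
    & double_comul_rel (fun b g => Phi (copy b g))].
Proof.
case=> betaP buniv.
have [Phi [[PhiC betaPhi] _]] := alpha_universal n_gt2 betaP.
have [Psi [[PsiC alphaPsi] _]] := buniv K alpha (alpha_isometric_coaction R n).
have PhiE x h : Phi (alpha x h) = beta x h by rewrite betaPhi [RHS]ffunE.
have PsiE x h : Psi (beta x h) = alpha x h.
  have := congr1 (fun f : galg 'S_n K => f h) (alphaPsi x).
  by rewrite [X in _ = X]ffunE => <-.
have PhiK : cancel Phi Psi.
  apply: (double_hom_ext n_gt2 (f := Psi \o Phi) (f' := id)) => //.
    by case: PhiC PsiC => [PhiP _] [PsiP _]; exact: is_star_hom_comp PhiP PsiP.
  by move=> x h /=; rewrite PhiE PsiE.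
(* The coefficients of [beta] are not known to generate [G], so this composite is identified by the
   uniqueness clause for [beta] itself. *)
have PsiK : cancel Psi Phi.
  have [Th [_ Thuniq]] := buniv G beta betaP.
  have ThE : Th = Phi \o Psi.
    apply: Thuniq; split; first exact: cqg_compatible_comp PsiC PhiC.
    by move=> x; apply/ffunP => h; rewrite ffunE /= PsiE PhiE.
  have Thid : Th = id.
    apply: Thuniq; split; first exact: cqg_compatible_id.
    by move=> x; apply/ffunP => h; rewrite ffunE.
  by move=> y; rewrite -[RHS]/(id y) -Thid ThE.
have [PhiP [Phi2 [[Phi2P Phi2t] Phi2D]]] := PhiC.
exists Phi; split=> //; first by exists Psi.
move=> b g; rewrite -Phi2D.
have -> : cqg_comul (copy b g : K) = comul_copy R (@theta n) b g.
  exact: double_comul_copy.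
have [Phi2l _ _ _] := Phi2P.
by rewrite /comul_copy (linear_add Phi2l) !Phi2t.
Qed.

Section Model.
Variables (G : compact_quantum_group R) (Phi : Kalg -> G).
Hypotheses (PhiP : is_star_hom Phi) (Phi_bij : bijective Phi).
Let w b g := Phi (copy b g).
Hypothesis w_comul : double_comul_rel w.

Let wP : double_rep w.
Proof. exact: double_rep_comp (copy_double_rep R 'S_n) PhiP. Qed.

Let span_bij : bijective (double_span w).
Proof.
have [Phil _ _ _] := PhiP.
apply: (eq_bij (bij_comp Phi_bij (double_span_copy_bij R 'S_n))) => u /=.
rewrite /double_span (linear_sumr Phil); apply: eq_bigr => p _.
exact: linear_scale.
Qed.

(** The coefficients are those of [doubling_comulE]. For given [x] and [a] only [y = twist a x]
    contributes, and setting [b] to the sum of the bits [a] and [c] gives the two terms of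
    [double_comul_rel]. *)
Lemma double_span_comul u :
  cqg_comul (double_span w u) = \sum_(p : ('S_n * bool) * ('S_n * bool))
    ((p.1.1 == twist p.1.2 p.2.1)%:R * u (p.1.1, p.1.2 (+) p.2.2)) *:
    cqg_tens (w p.1.2 p.1.1) (w p.2.2 p.2.1).
Proof.
have [Dl _ _ _] := cqg_comul_hom G.
rewrite (linear_sumr Dl).
under eq_bigr => p _ do rewrite (linear_scale Dl) w_comul scalerDr.
rewrite big_split /= -(pair_bigA _ (fun p q => ((p.1 == twist p.2 q.1)%:R *
  u (p.1, p.2 (+) q.2)) *: cqg_tens (w p.2 p.1) (w q.2 q.1))) /=.
transitivity (\sum_x \sum_a \sum_(q : 'S_n * bool) ((x == twist a q.1)%:R *
  u (x, a (+) q.2)) *: cqg_tens (w a x) (w q.2 q.1)); last first.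
  by rewrite pair_bigA; apply: eq_bigr => -[].
have inner x a : \sum_(q : 'S_n * bool) ((x == twist a q.1)%:R *
      u (x, a (+) q.2)) *: cqg_tens (w a x) (w q.2 q.1) =
    \sum_c u (x, a (+) c) *: cqg_tens (w a x) (w c (twist a x)).
  transitivity (\sum_y \sum_c ((x == twist a y)%:R * u (x, a (+) c)) *:
      cqg_tens (w a x) (w c y)).
    by rewrite pair_bigA; apply: eq_bigr => -[].
  rewrite (bigD1 (twist a x)) //= twistK eqxx [X in _ + X]big1 ?addr0 => [|y
    ya].
    by apply: eq_bigr => c _; rewrite mul1r.
  apply: big1 => c _; rewrite eq_sym (can2_eq (@twistK n a) (@twistK n a)).
  by rewrite (negbTE ya) mul0r scale0r.
rewrite -big_split /=; transitivity (\sum_x \sum_b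
    (u (x, b) *: cqg_tens (w false x) (w b x) +
     u (x, b) *: cqg_tens (w true x) (w (~~ b) (theta x)))).
  by rewrite pair_bigA; apply: eq_bigr => -[].
apply: eq_bigr => x _.
under [RHS]eq_bigr => a _ do rewrite inner.
by rewrite !big_bool /= addrACA [RHS]addrC; congr (_ + _); rewrite addrC.
Qed.

Lemma model_iso_hopf :
  cqg_iso_hopf G (doubling (group_hopf R[i] 'S_n) (@theta_lin R n)).
Proof.
exists (double_span w); split.
- by split; [exact: double_span_linear|exact: span_bij].
- by apply: (double_span1 wP) => g b; exact: doubling_oneE.
- by move=> u v; apply: (double_spanM wP) => g b; exact: doubling_mulE.
- by move=> u; apply: (double_span_star wP) => g b; exact: doubling_starE.
move=> u; rewrite double_span_comul; apply: eq_bigr => -[[x a] [y c]] _.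
rewrite !double_span_basis /=; congr (_ *: _).
exact: (esym (doubling_comulE u x y a c)).
Qed.

Definition pack (v : CSn * CSn) : {ffun 'S_n * bool -> R[i]^o} :=
  [ffun p => if p.2 then v.2 p.1 else v.1 p.1].

Lemma packE v g b : pack v (g, b) = if b then v.2 g else v.1 g.
Proof. by rewrite ffunE. Qed.

Lemma pack_bij : bijective pack.
Proof.
exists (fun u : {ffun 'S_n * bool -> R[i]^o} =>
  ([ffun g => u (g, false)] : CSn, [ffun g => u (g, true)] : CSn)).
  by case=> x y; congr (_, _); apply/ffunP => g; rewrite !ffunE.
by move=> u; apply/ffunP => -[g []]; rewrite packE /= ffunE.
Qed.

Lemma model_direct_sum :
  exists psi : CSn * CSn -> G,
    [/\ is_star_hom psi, bijective psi
      & forall i : 'I_n.-1,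
        cqg_comul (psi (sigma R i)) =
          cqg_tens (psi (sigma R i)) (psi (sigma R i)) +
          cqg_tens (psi (tau R i)) (psi (tau R (rev_ord i))) /\
        cqg_comul (psi (tau R i)) =
          cqg_tens (psi (sigma R i)) (psi (tau R i)) +
          cqg_tens (psi (tau R i)) (psi (sigma R (rev_ord i)))].
Proof.
have Fl := double_span_linear w.
exists (double_span w \o pack); split.
- split.
  + move=> c x y /=; rewrite -Fl; congr double_span; apply/ffunP => -[g b].
    rewrite packE [RHS]ffunE [X in _ = X + _]ffunE !packE.
    by case: b => /=; rewrite ffunE [X in X + _]ffunE.
  + apply: (double_span1 wP) => g b; rewrite packE.
    by case: b; exact: (deltaE R[i] 1%g g).
  + move=> x y /=; apply: (double_spanM wP) => g b; rewrite packE /=.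
    case: b; rewrite galg_mulE; apply: eq_bigr => z _; by rewrite !packE.
  + move=> x /=; apply: (double_span_star wP) => g b; rewrite !packE /=.
    by case: b; rewrite galg_conjE.
- exact: bij_comp span_bij pack_bij.
have psi_sigma i : double_span w (pack (sigma R i)) = w false (sgen i).
  rewrite -[RHS](double_span_basis w (sgen i, false)); congr double_span.
  by apply/ffunP => -[g []]; rewrite packE !ffunE xpair_eqE ?andbT ?andbF.
have psi_tau i : double_span w (pack (tau R i)) = w true (sgen i).
  rewrite -[RHS](double_span_basis w (sgen i, true)); congr double_span.
  by apply/ffunP => -[g []]; rewrite packE !ffunE xpair_eqE ?andbT ?andbF.
by move=> i /=; rewrite !psi_sigma !psi_tau !w_comul theta_sgen.
Qed.

End Model.

End MainTheorem.

Theorem theorem1p1 (R : realType) (n : nat) (hn : (2 < n)%N) :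
  (exists (K : compact_quantum_group R)
          (alpha : galg 'S_n R[i]^o -> galg 'S_n K),
     is_quantum_isometry_group alpha) /\
  forall (K : compact_quantum_group R)
         (alpha : galg 'S_n R[i]^o -> galg 'S_n K),
    is_quantum_isometry_group alpha ->
    cqg_iso_hopf K (doubling (group_hopf R[i] 'S_n) (@theta_lin R n)) /\
    exists psi : galg 'S_n R[i]^o * galg 'S_n R[i]^o -> K,
      [/\ is_star_hom psi, bijective psi
        & forall i : 'I_n.-1,
          cqg_comul (psi (sigma R i)) =
            cqg_tens (psi (sigma R i)) (psi (sigma R i)) +
            cqg_tens (psi (tau R i)) (psi (tau R (rev_ord i))) /\
          cqg_comul (psi (tau R i)) =
            cqg_tens (psi (sigma R i)) (psi (tau R i)) +
            cqg_tens (psi (tau R i)) (psi (sigma R (rev_ord i)))].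
Proof.
split.
  exists (double_cqg R (@thetaM n) (@thetaK n)), (double_coaction (@copy R
    'S_n)).
  exact: alpha_quantum_isometry_group.
move=> K alpha /(quantum_isometry_group_iso hn)[Phi [PhiP Phi_bij Phi_comul]].
split; first exact: model_iso_hopf PhiP Phi_bij Phi_comul.
exact: model_direct_sum PhiP Phi_bij Phi_comul.
Qed.
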